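(* Let $G=\mathbb{T}\ltimes\mathbb{Z}_2$, where $\mathbb{T}=\{s\in\mathbb{C}:|s|=1\}$, $\mathbb{Z}_2=\{-1,1\}$, with group law $(s,a)(t,b)=(st^a,ab)$. Then $\mathrm{ZL}^1(G)$ is amenable.
   Context: $G$ is a compact group; $\mathrm{L}^1(G)$ is its convolution algebra (normalised Haar measure) and $\mathrm{ZL}^1(G)$ its centre. A Banach algebra $\mathfrak{A}$ is amenable if it has a bounded approximate diagonal: a bounded net $(\mu_\alpha)$ in $\mathfrak{A}\hat\otimes\mathfrak{A}$ with $m(\mu_\alpha)a\to a$, $a\,m(\mu_\alpha)\to a$, $a\cdot\mu_\alpha-\mu_\alpha\cdot a\to0$ for all $a$ ($m$ multiplication, $a\cdot(b\otimes c)=ab\otimes c$, $(b\otimes c)\cdot a=b\otimes ca$). *)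

(* Defs.v *)
From mathcomp Require Import all_boot all_order all_algebra.
From mathcomp Require Import all_classical all_reals all_analysis.
From mathcomp Require Import complex.
From Stdlib Require List.
Set Implicit Arguments. Unset Strict Implicit. Unset Printing Implicit Defensive.
Import Order.TTheory GRing.Theory Num.Theory.
Local Open Scope classical_set_scope.
Local Open Scope ring_scope.

(* The group G = T ⋊ Z_2 with (s,a)(t,b) = (s t^a, ab).                   *)
(* An element (s,a) is encoded as (θ, a) with s = exp(2πiθ), θ ∈ [0,1),   *)
(* and a : bool with true <-> +1, false <-> -1.  Functions on G are       *)
(* functions R -> bool -> R[i]; only their values on [0,1) x bool matter. *)
(* Normalised Haar measure on G = (Lebesgue on [0,1)) x (uniform on Z_2). *)

Section ZL1.
Variable R : realType.

Definition CC := R[i].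

Definition sgnb (b : bool) : R := if b then 1 else -1.

Definition fr (x : R) : R := x - (Num.floor x)%:~R.

Definition cabs (z : CC) : R := Num.sqrt (complex.Re z ^+ 2 + complex.Im z ^+ 2).

Definition fnG := R -> bool -> CC.

Definition I01 : set R := `[0%R, 1%R[.

Definition rint (h : R -> R) : R := Rintegral lebesgue_measure I01 h.

Definition cint (h : R -> CC) : CC :=
  Complex (rint (fun t => complex.Re (h t))) (rint (fun t => complex.Im (h t))).

Definition nrm (f : fnG) : \bar R :=
  ((2^-1)%:E * ((\int[lebesgue_measure]_(t in I01) (cabs (f t true))%:E)
              + (\int[lebesgue_measure]_(t in I01) (cabs (f t false))%:E)))%E.

Definition inL1 (f : fnG) : Prop :=
  (forall a : bool,
     measurable_fun I01 (fun t => complex.Re (f t a)) /\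
     measurable_fun I01 (fun t => complex.Im (f t a))) /\
  (nrm f < +oo)%E.

Definition subG (f g : fnG) : fnG := fun t a => f t a - g t a.

(* convolution: (f*g)(x) = ∫_G f(y) g(y^{-1} x) dy, where for y = (φ,b),
   x = (θ,a) one has y^{-1} x = (b(θ-φ) mod 1, ba). *)
Definition conv (f g : fnG) : fnG := fun th a =>
  (Complex (2^-1) 0 : CC) * (cint (fun ph => f ph true * g (fr (sgnb true * (th - ph))) (true == a))
             + cint (fun ph => f ph false * g (fr (sgnb false * (th - ph))) (false == a))).

Definition inZL1 (f : fnG) : Prop :=
  inL1 f /\ forall g, inL1 g -> nrm (subG (conv f g) (conv g f)) = 0%E.

(* finite tensors in ZL^1(G) ⊗ ZL^1(G), given by representations Σ u_i ⊗ v_i *)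
Definition tens := seq (fnG * fnG).

Definition tensZ (m : tens) : Prop := forall p, List.In p m -> inZL1 p.1 /\ inZL1 p.2.

Definition cost (m : tens) : \bar R := (\sum_(p <- m) (nrm p.1 * nrm p.2))%E.

Definition kern (m : tens) : R -> bool -> R -> bool -> CC :=
  fun th a ph b => \sum_(p <- m) p.1 th a * p.2 ph b.

Definition nrm2 (k : R -> bool -> R -> bool -> CC) : \bar R :=
  ((4^-1)%:E * \sum_(a <- [:: true; false]) \sum_(b <- [:: true; false])
     \int[lebesgue_measure]_(th in I01) \int[lebesgue_measure]_(ph in I01)
        (cabs (k th a ph b))%:E)%E.

(* m and m' represent the same element of ZL^1 ⊗ ZL^1 *)
Definition tens_eq (m m' : tens) : Prop :=
  nrm2 (fun th a ph b => kern m th a ph b - kern m' th a ph b) = 0%E.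

Definition projnorm_lt (m : tens) (eps : R) : Prop :=
  exists m', tensZ m' /\ tens_eq m m' /\ (cost m' < eps%:E)%E.

Definition mult (m : tens) : fnG :=
  fun th a => \sum_(p <- m) conv p.1 p.2 th a.

(* module actions: a·(b⊗c) = ab⊗c, (b⊗c)·a = b⊗ca; commutator a·m - m·a *)
Definition comm_act (f : fnG) (m : tens) : tens :=
  [seq (conv f p.1, p.2) | p <- m] ++
  [seq ((fun th a => - p.1 th a), conv p.2 f) | p <- m].

(* ZL^1(G) is amenable: it has a bounded approximate diagonal.  The net is
   indexed by pairs (finite subset F of ZL^1, eps > 0); elements of the
   completed projective tensor product are approximated by finite tensors. *)
Definition ZL1_amenable : Prop :=
  exists C : R, 0 < C /\
    forall (F : seq fnG) (eps : R),
      (forall f, List.In f F -> inZL1 f) -> 0 < eps ->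
      exists m : tens, tensZ m /\ (cost m <= C%:E)%E /\
        forall f, List.In f F ->
          (nrm (subG (conv (mult m) f) f) < eps%:E)%E /\
          (nrm (subG (conv f (mult m)) f) < eps%:E)%E /\
          projnorm_lt (comm_act f m) eps.

End ZL1.

(* Main.v *)
(* Let e_n = cos(2 pi n x), with x in [0,1).  Central functions on G are the
   pairs (f, w) with f even on T and w constant on the coset of reflections, and
   each of them acts diagonally on the functions e_n on T.  Writing F for the
   Fejer kernel and u_t = (F(x - t) + F(x + t)) / 2, the tensors
     m = (8/N) sum_j u_(t_j) (x) u_(t_j) - 6 . 1_T (x) 1_T + 2 . 1_(G\T) (x) 1_(G\T)
   have bounded cost because u_t >= 0.  For midpoint nodes t_j of a half circle
   the quadrature is exact on the frequencies involved, so m is diagonal in the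
   e_n and commutes exactly with every central f.  Finally the T-part of mult m
   is 2 (1 + 2 sum_n a_n^2 e_n), where a_n = 1 - n/N; its half K is a nonnegative
   kernel of mass 1 with first Fourier coefficient a_1^2 -> 1, and a
   Korovkin argument gives K * f -> f in L^1. *)

Require Import Defs.
From mathcomp Require Import all_boot all_order all_algebra.
From mathcomp Require Import all_classical all_reals all_analysis.
From mathcomp Require Import measurable_realfun complex ring lra zify.
From Stdlib Require List.
Set Implicit Arguments. Unset Strict Implicit. Unset Printing Implicit Defensive.
Import Order.TTheory GRing.Theory Num.Theory.
Import numFieldNormedType.Exports.
Local Open Scope classical_set_scope.
Local Open Scope ring_scope.

(** * Integrals of 1-periodic functions *)

(** The obstacle is the cost. Written as a sum of multiples of e_n (x) e_n, the same tensor would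
    have a cost growing linearly in N; the average over nodes rewrites it with N terms of cost of
    order 1/N. The constants come from the fact that T has Haar mass 1/2. For n >= 1, e_n * e_n =
    e_n / 4, so 4 e_n is idempotent and the ideal entry at frequency n is 16 e_n (x) e_n; the factor
    8/N turns the quadrature into 16 a_n^2. At frequency 0, the functions 2 . 1_T and 2 . 1_(G\T)
    multiply like the two elements of Z_2, and the diagonal of the group algebra of Z_2 is 2 . 1_T
    (x) 1_T + 2 . 1_(G\T) (x) 1_(G\T). The quadrature gives 8 at frequency 0, whence the correction
    -6. Centrality of f is an identity up to null sets only. In the commutator f is convolved with
    trigonometric polynomials alone, so only its Fourier coefficients matter, and these are read off
    from commutators with cosines and sines placed on the reflections. *)

Section Translation.
Variable R : realType.
Notation mu := (@lebesgue_measure R).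
Implicit Types (f P : R -> \bar R) (c : R) (D : set R).

Lemma measurable_shift c : measurable_fun [set: measurableTypeR R]
  ((fun x => x + c) : measurableTypeR R -> measurableTypeR R).
Proof. by apply: measurable_funD. Qed.

Lemma measurable_opp : measurable_fun [set: measurableTypeR R]
  (-%R : measurableTypeR R -> measurableTypeR R).
Proof. exact: oppr_measurable. Qed.

Lemma preimage_shift_itv c (b1 b2 : bool) (x y : R) :
  (fun t : R => t + c) @^-1` [set` Interval (BSide b1 x) (BSide b2 y)] =
  [set` Interval (BSide b1 (x - c)) (BSide b2 (y - c))].
Proof.
by apply/seteqP; split=> t /=; rewrite !in_itv /=; case: b1; case: b2 => /=;
  rewrite ?lerBlDr ?lerBrDr ?ltrBlDr ?ltrBrDr.
Qed.

(** Lebesgue measure is determined by its values on intervals, and shifting preserves their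
    length. *)
Lemma lebesgue_measure_shift c D : measurable D ->
  pushforward mu ((fun x => x + c) : measurableTypeR R -> measurableTypeR R) D
  = mu D.
Proof.
move=> mD; apply/esym/lebesgue_measure_unique => //=.
  exact: measurable_shift.
move=> mf _ [[a b]] _ <-; rewrite /pushforward preimage_shift_itv.
rewrite !lebesgue_measure_itv/= !lte_fin ltrD2r; case: ifP => // _.
by rewrite -!EFinB; congr EFin; ring.
Qed.

Lemma ge0_integral_shift c f D : measurable D -> measurable_fun D f ->
  (forall x, 0 <= f x)%E ->
  (\int[mu]_(x in (fun t : R => t + c)%R @^-1` D) f (x + c)%R = \int[mu]_(x in D) f x)%E.
Proof.
move=> mD mf f0.
rewrite -(ge0_integral_pushforward (measurable_shift c))//.
apply: eq_measure_integral => /=; first exact: measurable_shift.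
by move=> mc A mA _; rewrite lebesgue_measure_shift.
Qed.

Lemma ge0_integral_opp f D : measurable D -> measurable_fun D f ->
  (forall x, 0 <= f x)%E ->
  (\int[mu]_(x in -%R @^-1` D) f (- x)%R = \int[mu]_(x in D) f x)%E.
Proof.
move=> mD mf f0.
rewrite -(ge0_integral_pushforward measurable_opp)//.
apply: eq_measure_integral => //= A mA _; exact: lebesgue_measureN.
Qed.

End Translation.

(** * Invariance of the integral over a period under translation and reflection *)

Section Periodic.
Variable R : realType.
Notation mu := (@lebesgue_measure R).
Notation I := (@I01 R).
Implicit Types (P : R -> \bar R) (c : R).

Lemma I01E (x : R) : I x <-> 0 <= x < 1.
Proof. by rewrite /I01 /= in_itv. Qed.

Lemma measurable_I01 : measurable (I : set (measurableTypeR R)).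
Proof. exact: measurable_itv. Qed.

Lemma fr_I01 (x : R) : I (fr x).
Proof.
apply/I01E; rewrite /fr.
by have := floor_itv x; rewrite intrD => /andP[? ?]; apply/andP; split; lra.
Qed.

Lemma fr_id (x : R) : I x -> fr x = x.
Proof.
move=> /I01E x01; rewrite /fr (_ : Num.floor x = 0) ?subr0//.
by apply/eqP; rewrite floor_eq add0r.
Qed.

Lemma periodic_natr (T : Type) (P : R -> T) : (forall x, P (x + 1) = P x) ->
  forall (n : nat) x, P (x + n%:R) = P x.
Proof.
move=> P1; elim=> [x|n IH x]; first by rewrite addr0.
by rewrite -natr1 addrA P1.
Qed.

Lemma periodic_intr (T : Type) (P : R -> T) : (forall x, P (x + 1) = P x) ->
  forall (z : int) x, P (x + z%:~R) = P x.
Proof.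
move=> P1 [n|n] x; first exact: periodic_natr.
by rewrite NegzE mulrNz -[in RHS](subrK n.+1%:R x) (periodic_natr P1).
Qed.

Lemma periodic_fr (T : Type) (P : R -> T) : (forall x, P (x + 1) = P x) ->
  forall x, P (fr x) = P x.
Proof.
by move=> P1 x; rewrite -(periodic_intr P1 (Num.floor x) (fr x)) /fr subrK.
Qed.

Lemma fr_periodic (x : R) : fr (x + 1) = fr x.
Proof. by rewrite /fr floorDrz ?floor1 ?intrD//; lra. Qed.

Lemma measurable_fr : measurable_fun [set: R] (@fr R).
Proof.
apply: measurable_funB => //; apply: nondecreasing_measurable => // x y xy.
by rewrite ler_int le_floor.
Qed.

Section Nonnegative.
Variable P : R -> \bar R.
Hypotheses (mP : measurable_fun setT P) (P0 : forall x, (0 <= P x)%E)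
  (P1 : forall x, P (x + 1) = P x).

(** After reduction to 0 <= c < 1, the argument runs over [c, 1 + c[; the piece [1, 1 + c[ is moved
    back by one period onto [0, c[. *)
Lemma ge0_integral_periodic_shift c :
  (\int[mu]_(x in I) P (x + c)%R = \int[mu]_(x in I) P x)%E.
Proof.
have mPD D : measurable_fun D P by exact: measurable_funTS.
wlog c01 : c / 0 <= c < 1.
  move=> /(_ (fr c)) <-; last by apply/I01E; exact: fr_I01.
  apply: eq_integral => x _; rewrite -(periodic_intr P1 (Num.floor c) (x + fr c)).
  by congr P; rewrite /fr; ring.
have /andP[c0 c1] := c01.
have -> : I = (fun t : R => t + c) @^-1` `[c, 1 + c[.
  by rewrite preimage_shift_itv subrr addrK.
rewrite ge0_integral_shift// preimage_shift_itv subrr addrK.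
rewrite (@itv_bndbnd_setU _ _ _ (BLeft 1) (BLeft (1 + c))) ?bnd_simp ?lerDl//; last exact: ltW.
rewrite [in RHS](@itv_bndbnd_setU _ _ (BLeft 0) (BLeft c) (BLeft 1)) ?bnd_simp//; last exact: ltW.
have disj (x y z : R) : [disjoint `[x, y[%classic & `[y, z[%classic].
  apply/disj_setPS => t /= []; rewrite !in_itv /= => /andP[_ ty] /andP[yt _].
  by move: (lt_le_trans ty yt); rewrite ltxx.
rewrite !ge0_integral_setU ?mPD//; try exact: mPD.
rewrite addeC; congr (_ + _)%E.
rewrite -[in LHS](@ge0_integral_shift R 1)// preimage_shift_itv subrr.
rewrite (_ : 1 + c - 1 = c); last ring.
by apply: eq_integral => x _; rewrite P1.
Qed.

Lemma ge0_integral_periodic_opp :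
  (\int[mu]_(x in I) P (- x)%R = \int[mu]_(x in I) P x)%E.
Proof.
have mPD D : measurable_fun D P by exact: measurable_funTS.
have -> : I = -%R @^-1` `](-1), 0].
  by rewrite opp_preimage_itvbndbnd oppr0 opprK.
(* Reflection lands on ]-1, 0] instead of [-1, 0[; exchanging the endpoints costs nothing, as points
   are null, and a shift by 1 finishes. *)
rewrite ge0_integral_opp// -(@integral_itv_bndo_bndc _ _ _ P)//.
rewrite [LHS](@integral_itv_obnd_cbnd _ _ _ P)//.
rewrite opp_preimage_itvbndbnd oppr0 opprK /=.
rewrite -[in RHS](@ge0_integral_shift R 1)// preimage_shift_itv subrr sub0r.
by apply: eq_integral => x _; rewrite P1.
Qed.

End Nonnegative.

Lemma ge0_integral_periodic P (s : bool) (th : R) : measurable_fun setT P ->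
  (forall x, 0 <= P x)%E -> (forall x, P (x + 1) = P x) ->
  (\int[mu]_(x in I) P (sgnb R s * (th - x))%R = \int[mu]_(x in I) P x)%E.
Proof.
move=> mP P0 P1.
have P1z := periodic_intr P1.
case: s; rewrite /sgnb; last first.
  under eq_integral do rewrite mulN1r opprB.
  exact: ge0_integral_periodic_shift.
rewrite -[RHS]ge0_integral_periodic_opp// -[RHS](ge0_integral_periodic_shift _ _ _ (- th)).
- by apply: eq_integral => x _; congr P; ring.
- by apply: measurableT_comp => //; exact: oppr_measurable.
- by [].
- by move=> x; rewrite -[in RHS](P1z (-1)) mulrN1z; congr P; ring.
Qed.

(** Invariance of Haar measure on T under translation and inversion, in the form produced by [conv].
    Composing with [fr] makes [F] periodic on the whole line; positive and negative parts reduce to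
    the nonnegative case. *)
Lemma integral_fr (F : R -> R) (s : bool) (th : R) : measurable_fun I F ->
  (\int[mu]_(x in I) (F (fr (sgnb R s * (th - x))))%:E
   = \int[mu]_(x in I) (F x)%:E)%E.
Proof.
move=> mF; have mI := measurable_I01.
pose P x := (F (fr x))%:E.
have mP : measurable_fun setT P.
  apply/measurable_EFinP.
  (* [F] is measurable on [I] only, so it is replaced by its extension by zero, which agrees with it
     at every value of [fr]. *)
  rewrite [X in measurable_fun _ X](_ : _ = (F \_ I) \o @fr R); last first.
    by apply/funext => x /=; rewrite patchE mem_set//; exact: fr_I01.
  apply: measurableT_comp; last exact: measurable_fr.
  exact: (iffLR (measurable_restrictT F mI) mF).
have P1 x : P (x + 1) = P x by rewrite /P fr_periodic.
have -> : (\int[mu]_(x in I) (F x)%:E = \int[mu]_(x in I) P x)%E.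
  by apply: eq_integral => x /set_mem xI; rewrite /P fr_id.
transitivity (\int[mu]_(x in I) P (sgnb R s * (th - x))%R)%E; first by [].
rewrite integralE [RHS]integralE; congr (_ - _)%E.
- transitivity (\int[mu]_(x in I) (P^\+)%E (sgnb R s * (th - x))%R)%E.
    by apply: eq_integral => x _; rewrite !funeposE.
  apply: ge0_integral_periodic => //; first exact: measurable_funepos.
  by move=> x; rewrite !funeposE P1.
- transitivity (\int[mu]_(x in I) (P^\-)%E (sgnb R s * (th - x))%R)%E.
    by apply: eq_integral => x _; rewrite !funenegE.
  apply: ge0_integral_periodic => //; first exact: measurable_funeneg.
  by move=> x; rewrite !funenegE P1.
Qed.

Lemma rint_fr (F : R -> R) (s : bool) (th : R) : measurable_fun I F ->
  rint (fun x => F (fr (sgnb R s * (th - x)))) = rint F.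
Proof. by move=> mF; rewrite /rint /Rintegral integral_fr. Qed.

End Periodic.

(** * Trigonometric integrals on [0,1) *)

Section Trig.
Variable R : realType.
Notation mu := (@lebesgue_measure R).
Notation I := (@I01 R).
Implicit Types (h k : R -> R) (n : nat) (x y c : R).

(** [rint] is the finite part of an extended integral and is linear only on integrable functions;
    [Lint] is the side condition that travels with it. *)
Definition Lint h := mu.-integrable I (EFin \o h).

Lemma continuous_bounded h : continuous h ->
  exists2 M : R, 0 <= M & forall x, 0 <= x <= 1 -> `|h x| <= M.
Proof.
move=> ch; have : bounded_set (h @` `[0, 1]%classic).
  apply: compact_bounded; apply: continuous_compact; last exact: segment_compact.
  exact: continuous_subspaceT.
move=> [M [_ hM]]; exists (`|M| + 1); first by rewrite addr_ge0.
move=> x x01; apply: hM; first by rewrite (le_lt_trans (ler_norm _))// ltrDl.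
by exists x => //=; rewrite in_itv.
Qed.

Lemma Lint_measurable h : Lint h -> measurable_fun I h.
Proof. by move=> /integrableP[/measurable_EFinP]. Qed.

Lemma continuous_measurableI h : continuous h -> measurable_fun I h.
Proof. by move=> ch; apply: measurable_funTS; exact: continuous_measurable_fun. Qed.

Lemma bounded_I01 h : continuous h -> [bounded h x | x in I].
Proof.
move=> ch; have [M M0 hM] := continuous_bounded ch.
exists M; split; first exact: num_real.
move=> y My x /I01E /andP[x0 x1]; apply: (le_trans _ (ltW My)).
by apply: hM; rewrite x0 ltW.
Qed.

Lemma lebesgue_I01 : mu I = 1%E.
Proof. by rewrite /I01 lebesgue_measure_itv /= lte_fin ltr01 oppr0 adde0. Qed.

Lemma Lint_continuous h : continuous h -> Lint h.
Proof.
move=> ch; apply: measurable_bounded_integrable.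
- exact: measurable_I01.
- have muI : (mu I < +oo)%E by rewrite lebesgue_I01 ltry.
  exact: muI.
- exact: continuous_measurableI.
- exact: bounded_I01.
Qed.

Lemma LintM h k : Lint h -> continuous k -> Lint (fun x => h x * k x).
Proof.
move=> ih ck; have /= := integrableMl (@measurable_I01 R) ih
  (continuous_measurableI ck) (bounded_I01 ck).
by apply: eq_integrable => //; exact: measurable_I01.
Qed.

Lemma LintD h k : Lint h -> Lint k -> Lint (fun x => h x + k x).
Proof.
move=> ih ik; have /= := integrableD (@measurable_I01 R) ih ik.
by apply: eq_integrable => //; exact: measurable_I01.
Qed.

Lemma LintB h k : Lint h -> Lint k -> Lint (fun x => h x - k x).
Proof.
move=> ih ik; have /= := integrableB (@measurable_I01 R) ih ik.
by apply: eq_integrable => //; exact: measurable_I01.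
Qed.

Lemma LintZ c h : Lint h -> Lint (fun x => c * h x).
Proof.
move=> ih; have /= := integrableZl (@measurable_I01 R) c ih.
by apply: eq_integrable => //; exact: measurable_I01.
Qed.

Lemma Lint_norm h : Lint h -> Lint (fun x => `|h x|).
Proof. by move=> ih; exact: integrable_norm. Qed.

Lemma Lint_cst c : Lint (fun=> c).
Proof. by apply: Lint_continuous => x; exact: cvg_cst. Qed.

Lemma Lint_sum (T : Type) (s : seq T) (F : T -> R -> R) :
  (forall i, Lint (F i)) -> Lint (fun x => \sum_(i <- s) F i x).
Proof.
move=> iF; elim: s => [|i s IH].
  by rewrite (_ : (fun _ => _) = fun=> 0) ?Lint_cst//; apply/funext => x; rewrite big_nil.
rewrite (_ : (fun _ => _) = fun x => F i x + \sum_(j <- s) F j x).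
  exact: LintD.
by apply/funext => x; rewrite big_cons.
Qed.

Lemma rintD h k : Lint h -> Lint k -> rint (fun x => h x + k x) = rint h + rint k.
Proof. by move=> ih ik; rewrite /rint RintegralD//; exact: measurable_I01. Qed.

Lemma rintB h k : Lint h -> Lint k -> rint (fun x => h x - k x) = rint h - rint k.
Proof. by move=> ih ik; rewrite /rint RintegralB//; exact: measurable_I01. Qed.

Lemma rintZ c h : Lint h -> rint (fun x => c * h x) = c * rint h.
Proof. by move=> ih; rewrite /rint RintegralZl//; exact: measurable_I01. Qed.

Lemma rint_cst c : rint (fun=> c) = c.
Proof.
rewrite /rint Rintegral_cst; last exact: measurable_I01.
by rewrite [X in fine X](lebesgue_I01) mulr1.
Qed.

Lemma eq_rint h k : (forall x, I x -> h x = k x) -> rint h = rint k.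
Proof. by move=> hk; apply: eq_Rintegral => x /set_mem; exact: hk. Qed.

Lemma rint_sum (T : Type) (s : seq T) (F : T -> R -> R) :
  (forall i, Lint (F i)) ->
  rint (fun x => \sum_(i <- s) F i x) = \sum_(i <- s) rint (F i).
Proof.
move=> iF; elim: s => [|i s IH].
  by rewrite big_nil -[RHS](rint_cst 0); apply: eq_rint => x _; rewrite big_nil.
rewrite big_cons -IH -rintD//; last exact: Lint_sum.
by apply: eq_rint => x _; rewrite big_cons.
Qed.

Lemma le_rint h k : Lint h -> Lint k -> (forall x, I x -> h x <= k x) ->
  rint h <= rint k.
Proof. by move=> ih ik hk; apply: le_Rintegral => //; exact: measurable_I01. Qed.

Lemma le_norm_rint h : Lint h -> `|rint h| <= rint (fun x => `|h x|).
Proof. by move=> ih; apply: le_normr_Rintegral => //; exact: measurable_I01. Qed.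

Lemma integral_rint h : Lint h -> (\int[mu]_(x in I) (h x)%:E)%E = (rint h)%:E.
Proof.
by move=> ih; rewrite /rint /Rintegral fineK//; exact: (integrable_fin_num (@measurable_I01 R)).
Qed.

Definition cosn n x : R := cos (2 * pi * n%:R * x).
Definition sinn n x : R := sin (2 * pi * n%:R * x).

Lemma continuous_affine (a b : R) : continuous (fun x => a * x + b).
Proof. by move=> x; apply: cvgD; [exact: mulrl_continuous|exact: cvg_cst]. Qed.

Lemma continuous_cosn n : continuous (cosn n).
Proof.
move=> x; apply: continuous_comp; first exact: mulrl_continuous.
exact: continuous_cos.
Qed.

Lemma continuous_sinn n : continuous (sinn n).
Proof.
move=> x; apply: continuous_comp; first exact: mulrl_continuous.
exact: continuous_sin.
Qed.

Lemma cosn0 x : cosn 0 x = 1.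
Proof. by rewrite /cosn mulr0 mul0r cos0. Qed.

Lemma sinn0 x : sinn 0 x = 0.
Proof. by rewrite /sinn mulr0 mul0r sin0. Qed.

Lemma cosnN n x : cosn n (- x) = cosn n x.
Proof. by rewrite /cosn mulrN cosN. Qed.

Lemma sinnN n x : sinn n (- x) = - sinn n x.
Proof. by rewrite /sinn mulrN sinN. Qed.

Lemma cosnD n x y : cosn n (x + y) = cosn n x * cosn n y - sinn n x * sinn n y.
Proof. by rewrite /cosn /sinn mulrDr cosD. Qed.

Lemma sinnD n x y : sinn n (x + y) = sinn n x * cosn n y + cosn n x * sinn n y.
Proof. by rewrite /cosn /sinn mulrDr sinD. Qed.

Lemma cosnB n x y : cosn n (x - y) = cosn n x * cosn n y + sinn n x * sinn n y.
Proof. by rewrite cosnD cosnN sinnN; ring. Qed.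

Lemma sinnB n x y : sinn n (x - y) = sinn n x * cosn n y - cosn n x * sinn n y.
Proof. by rewrite sinnD cosnN sinnN; ring. Qed.

Lemma cosn1_period n : cosn n 1 = 1 /\ sinn n 1 = 0.
Proof.
rewrite /cosn /sinn (_ : 2 * pi * n%:R * 1 = 0 + (pi *+ 2) *+ n); last first.
  by rewrite -mulr_natr -[pi *+ 2]mulr_natr; ring.
by rewrite (periodicn (@cosD2pi R)) (periodicn (@sinD2pi R)) cos0 sin0.
Qed.

Lemma cosn_periodic n x : cosn n (x + 1) = cosn n x.
Proof. by rewrite cosnD (cosn1_period n).1 (cosn1_period n).2; ring. Qed.

Lemma sinn_periodic n x : sinn n (x + 1) = sinn n x.
Proof. by rewrite sinnD (cosn1_period n).1 (cosn1_period n).2; ring. Qed.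

Lemma cosn_fr n x : cosn n (fr x) = cosn n x.
Proof. exact: (periodic_fr (cosn_periodic n)). Qed.

Lemma rint_cos (a b : R) : a != 0 ->
  rint (fun x => cos (a * x + b)) = (sin (a + b) - sin b) / a.
Proof.
move=> a0.
have cc : continuous (fun x => cos (a * x + b)).
  move=> x; apply: continuous_comp; first exact: continuous_affine.
  exact: continuous_cos.
have dF x : is_derive x 1 (fun x : R => a^-1 * sin (a * x + b)) (cos (a * x + b)).
  have H : is_derive x 1 (fun x : R => a^-1 * sin (a * x + b))
     (a^-1 *: (cos (a * x + b) *: (a *: 1 + 0))).
    apply: is_deriveZ; apply: is_derive1_comp.
  by move: H; rewrite addr0 /GRing.scale /= mulr1 mulrCA mulVf// mulr1.
have cF : continuous (fun x : R => a^-1 * sin (a * x + b)).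
  move=> x; apply: cvgM; first exact: cvg_cst.
  apply: continuous_comp; first exact: continuous_affine.
  exact: continuous_sin.
rewrite /rint Rintegral_itv_bndo_bndc; last exact: Lint_continuous.
rewrite /Rintegral (@continuous_FTC2 R _ (fun x => a^-1 * sin (a * x + b)))//=.
- by rewrite mulr1 mulr0 add0r; ring.
- exact: continuous_subspaceT.
- split.
  + by move=> x _; have [] := dF x.
  + by apply: cvg_at_right_filter; exact: cF.
  + by apply: cvg_at_left_filter; exact: cF.
- by move=> x _; rewrite derive1E; exact: derive_val.
Qed.

Lemma rint_cosn_shift n c : rint (fun x => cosn n (x + c)) = (n == 0)%:R.
Proof.
case: eqP => [->|/eqP n0].
  by rewrite -[RHS](rint_cst 1); apply: eq_rint => x _; rewrite cosn0.
have a0 : 2 * pi * n%:R != 0 :> R.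
  by rewrite !mulf_neq0 ?pnatr_eq0// gt_eqF// pi_gt0.
rewrite (_ : (fun _ => _) = fun x => cos (2 * pi * n%:R * x + 2 * pi * n%:R * c)).
  rewrite rint_cos//.
  rewrite (_ : sin _ = sinn n (c + 1)); last by rewrite /sinn; congr sin; ring.
  by rewrite sinn_periodic subrr mul0r.
by apply/funext => x; rewrite /cosn mulrDr.
Qed.

Lemma Lint_cosn n : Lint (cosn n).
Proof. by apply: Lint_continuous; exact: continuous_cosn. Qed.

Lemma rint_cosn n : rint (cosn n) = (n == 0)%:R.
Proof.
rewrite -(rint_cosn_shift n 0); congr rint; apply/funext => x; by rewrite addr0.
Qed.

Lemma rint_sinn n : rint (sinn n) = 0.
Proof.
have [->|n0] := eqVneq n 0.
  by rewrite -[RHS](rint_cst 0); apply: eq_rint => x _; rewrite sinn0.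
have an0 : n%:R != 0 :> R by rewrite pnatr_eq0.
(* A sine is a cosine delayed by a quarter of its period 1/n. *)
transitivity (rint (fun x => cosn n (x + - (4 * n%:R)^-1))); last first.
  by rewrite rint_cosn_shift (negbTE n0).
apply: eq_rint => x _; rewrite /sinn /cosn.
rewrite -cosBpihalf; congr cos; field.
by rewrite an0.
Qed.

Lemma cosnM (n k : nat) x : (k <= n)%N ->
  cosn n x * cosn k x = 2^-1 * (cosn (n + k) x + cosn (n - k) x).
Proof.
move=> kn; rewrite /cosn natrD natrB//.
rewrite (_ : 2 * pi * (n%:R + k%:R) * x = 2 * pi * n%:R * x + 2 * pi * k%:R * x); last ring.
rewrite (_ : 2 * pi * (n%:R - k%:R) * x = 2 * pi * n%:R * x - 2 * pi * k%:R * x); last ring.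
by rewrite cosD cosB; field.
Qed.

(** Product-to-sum leaves the frequencies n + k and n - k; both vanish when n = k = 0, which is why
    that value is 1 instead of 1/2. *)
Lemma rint_cosnM (n k : nat) : rint (fun x => cosn n x * cosn k x) =
  (n == k)%:R * (if n == 0%N then 1 else 2^-1).
Proof.
wlog kn : n k / (k <= n)%N.
  move=> W; case/orP: (leq_total k n) => [/W//|/W].
  rewrite (eq_sym k n) => E; transitivity (rint (fun x => cosn k x * cosn n x)).
    by apply: eq_rint => x _; rewrite mulrC.
  by rewrite E; case: eqP => [->|]//; rewrite !mul0r.
rewrite (eq_rint (k := fun x => 2^-1 * (cosn (n + k) x + cosn (n - k) x))); last first.
  by move=> x _; rewrite cosnM.
rewrite rintZ; last by apply: LintD; exact: Lint_cosn.
rewrite rintD ?rint_cosn; try exact: Lint_cosn.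
rewrite subn_eq0 addn_eq0 (eqn_leq n k) kn andbT.
have [nk|nk] := leqP n k; last first.
  by rewrite !mul0r gtn_eqF/= ?addr0 ?mulr0// (leq_ltn_trans _ nk).
have -> : k = n by apply/eqP; rewrite eqn_leq kn.
by rewrite andbb; case: (n == 0) => /=; field.
Qed.

End Trig.

(** * Fejer kernel and quadrature *)

Section Fejer.
Variable R : realType.
Implicit Types (x y : R).
Local Notation cosn := (@cosn R).
Local Notation sinn := (@sinn R).

(** The left side is the squared modulus of the sum of exp(2 pi i k x) over k < N, and the weights
    count the pairs of indices at distance n. Passing from N to N + 1 adds 1 + 2 sum cos(2 pi (N -
    k) x), which raises each weight by [e n]. *)
Lemma fejer_square (N : nat) x :
  (\sum_(k < N) cosn k x) ^+ 2 + (\sum_(k < N) sinn k x) ^+ 2 =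
  \sum_(n < N) (if n == 0%N :> nat then N%:R else 2 * (N%:R - n%:R)) * cosn n x.
Proof.
elim: N => [|N IH]; first by rewrite !big_ord0 expr0n addr0.
pose w (M n : nat) : R := if n == 0%N then M%:R else 2 * (M%:R - n%:R).
pose e (n : nat) : R := if n == 0%N then 1 else 2.
transitivity (\sum_(n < N.+1) w N n * cosn n x + \sum_(n < N.+1) e n * cosn n x);
  last first.
  rewrite -big_split; apply: eq_bigr => -[n nN] _ /=; rewrite -mulrDl.
  by congr (_ * _); rewrite /w /e; case: eqP => _; rewrite -natr1; ring.
have -> : \sum_(n < N.+1) w N n * cosn n x = \sum_(n < N) w N n * cosn n x.
  rewrite big_ord_recr /= (_ : w N N = 0) ?mul0r ?addr0//.
  by rewrite /w; case: eqP => [->//|_]; rewrite subrr mulr0.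
rewrite -IH !big_ord_recr /=.
have -> : \sum_(n < N) e n * cosn n x + e N * cosn N x =
    1 + 2 * \sum_(k < N) (cosn k x * cosn N x + sinn k x * sinn N x).
  transitivity (\sum_(n < N.+1) e n * cosn n x); first by rewrite big_ord_recr.
  rewrite big_ord_recl /=.
  rewrite /e /= cosn0 mulr1 mulr_sumr; congr (_ + _).
  (* Reversal of the index matches frequency N - k with the cross term of k and N. *)
  rewrite (reindex_inj rev_ord_inj) /=; apply: eq_bigr => -[k kN] _ /=.
  rewrite /bump /= add1n subnSK//; congr (_ * _).
  rewrite -[k in RHS](subKn (ltnW kN)) /cosn /sinn.
  rewrite [X in _ = X](_ : _ = cos (2 * pi * (N%:R - k%:R) * x)); last first.
    rewrite (_ : 2 * pi * (_ - _) * x = 2 * pi * N%:R * x - 2 * pi * k%:R * x); last ring.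
    by rewrite cosB subKn ?(ltnW kN)// mulrC [X in _ + X]mulrC.
  by rewrite natrB// ltnW.
rewrite big_split /= -!mulr_suml.
have := cos2Dsin2 (2 * pi * N%:R * x); rewrite -/(cosn N x) -/(sinn N x) => E.
nra.
Qed.

(** Cosine coefficients of the Fejer kernel of mass 1; the factor 2 merges the frequencies n and
    -n. *)
Definition fejerc (N n : nat) : R := if n == 0%N then 1 else 2 * (1 - n%:R / N%:R).

Definition trig (N : nat) (b : nat -> R) x : R := \sum_(n < N) b n * cosn n x.

Lemma fejer_ge0 N x : (0 < N)%N -> 0 <= trig N (fejerc N) x.
Proof.
move=> N0; have NR : N%:R != 0 :> R by rewrite pnatr_eq0 -lt0n.
rewrite -(pmulr_rge0 _ (_ : 0 < N%:R)) ?ltr0n//.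
have -> : N%:R * trig N (fejerc N) x =
    (\sum_(k < N) cosn k x) ^+ 2 + (\sum_(k < N) sinn k x) ^+ 2.
  rewrite fejer_square /trig mulr_sumr; apply: eq_bigr => n _; rewrite mulrA.
  by congr (_ * _); rewrite /fejerc; case: eqP => _; field.
by rewrite addr_ge0// sqr_ge0.
Qed.

(* The midpoints [node N j] of the half circle integrate exactly the cosines of
   frequency less than [2 * N]. *)
Definition node (N j : nat) : R := (2 * j%:R + 1) / (4 * N%:R).

Lemma sin_natpi (k : nat) : sin (pi * k%:R) = 0 :> R.
Proof.
elim: k => [|k IH]; first by rewrite mulr0 sin0.
by rewrite -natr1 mulrDr mulr1 sinDpi IH oppr0.
Qed.

(** Multiplying by sin(pi k / (2N)), nonzero because 0 < k < 2N, makes the sum telescope between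
    multiples of sin 0 and sin(pi k). *)
Lemma sum_cosn_node N k : (0 < k < 2 * N)%N ->
  \sum_(j < N) cosn k (node N j) = 0.
Proof.
move=> /andP[k0 k2N].
have N0 : (0 < N)%N by case: N k2N.
have NR : N%:R != 0 :> R by rewrite pnatr_eq0 -lt0n.
have NR0 : 0 < N%:R :> R by rewrite ltr0n.
pose s : R := sin (pi * k%:R / (2 * N%:R)).
have s0 : s != 0.
  rewrite gt_eqF// sin_gt0_pi//; apply/andP; split.
    by rewrite divr_gt0 ?mulr_gt0 ?pi_gt0 ?ltr0n.
  rewrite ltr_pdivrMr ?mulr_gt0// ltr_pM2l ?pi_gt0//.
  by rewrite -natrM ltr_nat.
apply: (mulfI s0); rewrite mulr0 mulr_sumr.
pose D (j : nat) : R := 2^-1 * sin (pi * k%:R * j%:R / N%:R).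
rewrite (eq_bigr (fun j : 'I_N => D j.+1 - D j)) => [|j _]; last first.
  rewrite /D /s /cosn /node -[j.+1%:R]natr1 -mulrBr.
  set a := pi * k%:R / (2 * N%:R).
  rewrite (_ : 2 * pi * k%:R * _ = a * (2 * j%:R + 1)); last by rewrite /a; field.
  rewrite (_ : pi * k%:R * (j%:R + 1) / N%:R = a * (2 * j%:R + 1) + a); last by rewrite /a; field.
  rewrite (_ : pi * k%:R * j%:R / N%:R = a * (2 * j%:R + 1) - a); last by rewrite /a; field.
  by rewrite sinD sinB; field.
rewrite -(big_mkord xpredT (fun j => D j.+1 - D j)) telescope_sumr//.
by rewrite /D mulr0 mul0r sin0 mulfK// sin_natpi subrr.
Qed.

(** Both frequencies n + k and n - k stay below 2N, where the nodes are exact, so orthogonality of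
    cosines survives discretisation. *)
Lemma quadrature N (n k : nat) : (n < N)%N -> (k < N)%N ->
  \sum_(j < N) cosn n (node N j) * cosn k (node N j) =
  (n == k)%:R * (if n == 0%N then N%:R else N%:R / 2).
Proof.
wlog kn : n k / (k <= n)%N.
  move=> W nN kN; case/orP: (leq_total k n) => [/W|/W]; first exact.
  rewrite (eq_sym k n) => /(_ kN nN) E; under eq_bigr do rewrite mulrC.
  by rewrite E; case: eqP => [->|]//; rewrite !mul0r.
move=> nN kN; under eq_bigr do rewrite cosnM//.
rewrite -mulr_sumr big_split /=.
have Z (l : nat) : (l < 2 * N)%N ->
    \sum_(j < N) cosn l (node N j) = (l == 0%N)%:R * N%:R.
  move=> l2; have [->|l0] := eqVneq l 0%N.
    rewrite mul1r (eq_bigr (fun=> 1)) => [|j _]; last exact: cosn0.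
    by rewrite sumr_const card_ord.
  by rewrite mul0r sum_cosn_node// lt0n l0.
rewrite !Z; [|lia|lia].
rewrite subn_eq0 addn_eq0 (eqn_leq n k) kn andbT.
have [nk|nk] := leqP n k; last first.
  by rewrite !mul0r gtn_eqF/= ?mul0r ?addr0 ?mulr0// (leq_ltn_trans _ nk).
have -> : k = n by apply/eqP; rewrite eqn_leq kn.
by rewrite andbb; case: (n == 0%N) => /=; field.
Qed.

(** Cosine coefficients of the average of the Fejer kernel translated by [node N j] and by its
    opposite: symmetrising removes the sines and keeps positivity. *)
Definition nodec (N j n : nat) : R := fejerc N n * cosn n (node N j).

(* Cosine coefficients of the convolution square of the Fejer kernel. *)
Definition fejer_sqc (N n : nat) : R :=
  fejerc N n ^+ 2 * (if n == 0%N then 1 else 2^-1).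

Lemma nodec_ge0 N j x : (0 < N)%N -> 0 <= trig N (nodec N j) x.
Proof.
move=> N0.
have -> : trig N (nodec N j) x = 2^-1 * (trig N (fejerc N) (x + node N j) +
   trig N (fejerc N) (x - node N j)).
  rewrite /trig -big_split mulr_sumr; apply: eq_bigr => n _ /=.
  by rewrite /nodec cosnD cosnB; field.
by rewrite mulr_ge0// addr_ge0// fejer_ge0.
Qed.

Lemma sum_nodec N (n k : nat) : (n < N)%N -> (k < N)%N ->
  N%:R^-1 * \sum_(j < N) nodec N j n * nodec N j k = (n == k)%:R * fejer_sqc N n.
Proof.
move=> nN kN; have NR : N%:R != 0 :> R by rewrite pnatr_eq0; case: N nN kN.
rewrite (eq_bigr (fun j : 'I_N => fejerc N n * fejerc N k *
   (cosn n (node N j) * cosn k (node N j)))); last first.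
  by move=> j _; rewrite /nodec; ring.
rewrite -mulr_sumr quadrature// /fejer_sqc.
have [->|_] := eqVneq n k; last by rewrite !mul0r !mulr0.
by case: eqP => _; field.
Qed.

(** The quadrature turns the convolution square into an average, over the nodes, of products of two
    nonnegative values, so no convolution integral has to be handled. *)
Lemma fejer_sqc_ge0 N x : (0 < N)%N -> 0 <= trig N (fejer_sqc N) x.
Proof.
move=> N0.
have -> : trig N (fejer_sqc N) x = N%:R^-1 * \sum_(j < N)
    trig N (nodec N j) x * trig N (fejerc N) (node N j).
  rewrite (eq_bigr (fun j : 'I_N => \sum_(n < N) \sum_(k < N)
    (nodec N j n * nodec N j k) * cosn n x)); last first.
    move=> j _; rewrite /trig mulr_suml; apply: eq_bigr => n _.
    by rewrite mulr_sumr; apply: eq_bigr => k _; rewrite /nodec; ring.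
  rewrite exchange_big mulr_sumr; apply: eq_bigr => n _ /=.
  rewrite exchange_big mulr_sumr (bigD1 n)//= [X in _ + X]big1 => [|k kn].
    by rewrite -mulr_suml mulrA sum_nodec// eqxx mul1r addr0.
  rewrite -mulr_suml mulrA sum_nodec// (_ : (n == k :> nat) = false) ?mul0r//.
  by rewrite eq_sym; exact: negbTE.
rewrite mulr_ge0 ?invr_ge0// sumr_ge0// => j _.
by rewrite mulr_ge0// ?nodec_ge0// fejer_ge0.
Qed.

Lemma fejer_sqc0 N : fejer_sqc N 0 = 1.
Proof. by rewrite /fejer_sqc /fejerc /= expr1n mulr1. Qed.

(** With t = 1/N the left side is 1 - (1 - t)^2. It is the integral of 1 - cos against the kernel,
    hence the rate in the Korovkin argument. *)
Lemma fejer_sqc1 N : (0 < N)%N -> 1 - fejer_sqc N 1 / 2 <= 2 / N%:R.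
Proof.
move=> N0; rewrite /fejer_sqc /fejerc /=; set t := 1%:R / N%:R.
have t0 : 0 <= t by rewrite divr_ge0.
rewrite (_ : 2 / N%:R = 2 * t) ?mul1r//; last by rewrite /t mul1r.
nra.
Qed.

End Fejer.

(** * Korovkin approximation in L^1 *)

Section Korovkin.
Variable R : realType.
Notation mu := (@lebesgue_measure R).
Notation I := (@I01 R).
Implicit Types (h g : R -> R) (b : nat -> R) (x y : R).
Local Notation cosn := (@cosn R).
Local Notation sinn := (@sinn R).

Lemma continuous_sum (N : nat) (F : nat -> R -> R) :
  (forall n, continuous (F n)) -> continuous (fun x => \sum_(n < N) F n x).
Proof.
move=> cF; elim: N => [|N IH].
  rewrite (_ : (fun _ => _) = fun=> 0); last by apply/funext => x; rewrite big_ord0.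
  by move=> x; exact: cvg_cst.
rewrite (_ : (fun _ => _) = fun x => \sum_(n < N) F n x + F N x); last first.
  by apply/funext => x; rewrite big_ord_recr.
by move=> x; apply: cvgD; [exact: IH|exact: cF].
Qed.

Lemma continuous_trig N b : continuous (trig N b).
Proof.
apply: (@continuous_sum N (fun n x => b n * cosn n x)) => n x.
by apply: cvgM; [exact: cvg_cst|exact: continuous_cosn].
Qed.

Lemma continuous_comp_sub h x : continuous h -> continuous (fun y => h (x - y)).
Proof.
move=> ch y; apply: continuous_comp; last exact: ch.
by apply: cvgB; [exact: cvg_cst|exact: cvg_id].
Qed.

Lemma trig_periodic N b x : trig N b (x + 1) = trig N b x.
Proof. by apply: eq_bigr => n _; rewrite cosn_periodic. Qed.

Lemma trig_fr N b x : trig N b (fr x) = trig N b x.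
Proof. exact: (periodic_fr (trig_periodic N b)). Qed.

Lemma rint_trig N b : (0 < N)%N -> rint (trig N b) = b 0%N.
Proof.
case: N => // N _; rewrite rint_sum; last by move=> n; apply: LintZ; exact: Lint_cosn.
rewrite (bigD1 ord0)//= big1 ?addr0 => [|n n0]; last first.
  rewrite rintZ; last exact: Lint_cosn.
  by rewrite rint_cosn (_ : (n == 0 :> nat)%N = false) ?mulr0//; exact: negbTE.
by rewrite rintZ ?rint_cosn ?mulr1//; exact: Lint_cosn.
Qed.

Lemma rint_trig_sub N b x : (0 < N)%N -> rint (fun y => trig N b (x - y)) = b 0%N.
Proof.
move=> N0; rewrite -(rint_trig b N0) -(@rint_fr _ (trig N b) true x); last first.
  by apply: continuous_measurableI; exact: continuous_trig.
by apply: eq_rint => y _; rewrite trig_fr /sgnb mul1r.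
Qed.

Lemma rint_cosn_trig_sub N b x : (1 < N)%N ->
  rint (fun y => cosn 1 (x - y) * trig N b (x - y)) = b 1%N / 2.
Proof.
move=> N1.
transitivity (rint (fun y => cosn 1 y * trig N b y)).
  rewrite -[RHS](@rint_fr _ (fun y => cosn 1 y * trig N b y) true x).
    by apply: eq_rint => y _; rewrite trig_fr cosn_fr /sgnb mul1r.
  apply: Lint_measurable; apply: LintM; first exact: Lint_cosn.
  exact: continuous_trig.
transitivity (\sum_(n < N) b n * rint (fun y => cosn n y * cosn 1 y)).
  rewrite -(@eq_bigr _ _ _ _ _ _ (fun n : 'I_N => rint (fun y => b n * (cosn n y * cosn 1 y)))).
    rewrite -rint_sum.
      by apply: eq_rint => y _; rewrite mulr_sumr; apply: eq_bigr => n _; ring.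
    move=> n; apply: LintZ; apply: LintM; first exact: Lint_cosn.
    exact: continuous_cosn.
  move=> n _; rewrite rintZ//; apply: LintM; first exact: Lint_cosn.
  exact: continuous_cosn.
rewrite (bigD1 (Ordinal N1))//= big1 ?addr0 => [|n n1].
  by rewrite rint_cosnM eqxx mul1r.
by rewrite rint_cosnM (_ : (n == 1 :> nat)%N = false) ?mul0r ?mulr0//; exact: negbTE.
Qed.

Lemma Lint_cosM h n : Lint h -> Lint (fun y => h y * cosn n y).
Proof. by move=> ih; apply: LintM => //; exact: continuous_cosn. Qed.

Lemma Lint_sinM h n : Lint h -> Lint (fun y => h y * sinn n y).
Proof. by move=> ih; apply: LintM => //; exact: continuous_sinn. Qed.

(** Addition formulas separate x from y, so the convolution is a finite combination of sines and
    cosines of x. Continuity in x and the double integral below follow without Fubini. *)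
Lemma rint_conv_trig N b h x : Lint h ->
  rint (fun y => h y * trig N b (x - y)) =
  \sum_(n < N) (b n * (cosn n x * rint (fun y => h y * cosn n y) +
                       sinn n x * rint (fun y => h y * sinn n y))).
Proof.
move=> ih.
have iC n := Lint_cosM n ih; have iS n := Lint_sinM n ih.
transitivity (\sum_(n < N) rint (fun y => b n *
    (cosn n x * (h y * cosn n y) + sinn n x * (h y * sinn n y)))).
  rewrite -rint_sum => [|n].
    apply: eq_rint => y _; rewrite mulr_sumr; apply: eq_bigr => n _.
    by rewrite cosnB; ring.
  by apply: LintZ; apply: LintD; exact: LintZ.
apply: eq_bigr => n _.
rewrite rintZ; last by apply: LintD; exact: LintZ.
rewrite rintD; [|exact: LintZ..].
by rewrite !rintZ.
Qed.

Lemma continuous_conv_trig N b h : Lint h ->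
  continuous (fun x => rint (fun y => h y * trig N b (x - y))).
Proof.
move=> ih; under eq_fun do rewrite rint_conv_trig//.
apply: (@continuous_sum N (fun n x => b n * (cosn n x * rint (fun y => h y * cosn n y) +
                       sinn n x * rint (fun y => h y * sinn n y)))) => n x.
apply: cvgM; first exact: cvg_cst.
apply: cvgD; apply: cvgM; try exact: cvg_cst.
  exact: continuous_cosn.
exact: continuous_sinn.
Qed.

(** Stands in for Fubini: integrating the finite expansion in x keeps only frequency 0. *)
Lemma rint_rint_conv_trig N b h : (0 < N)%N -> Lint h ->
  rint (fun x => rint (fun y => h y * trig N b (x - y))) = b 0%N * rint h.
Proof.
move=> N0 ih; under eq_fun do rewrite rint_conv_trig//.
have iC n : Lint (cosn n) by exact: Lint_cosn.
have iS n : Lint (sinn n) by apply: Lint_continuous; exact: continuous_sinn.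
have iCc n c : Lint (fun x => cosn n x * c).
  by under eq_fun do rewrite mulrC; exact: LintZ.
have iSc n c : Lint (fun x => sinn n x * c).
  by under eq_fun do rewrite mulrC; exact: LintZ.
rewrite rint_sum => [|n]; last by apply: LintZ; exact: LintD.
have E n : rint (fun x => b n * (cosn n x * rint (fun y => h y * cosn n y) +
   sinn n x * rint (fun y => h y * sinn n y))) =
   b n * ((n == 0%N)%:R * rint (fun y => h y * cosn n y)).
  rewrite rintZ; last exact: LintD.
  rewrite rintD// (eq_rint (fun y _ => mulrC (cosn n y) _)).
  rewrite (eq_rint (fun y _ => mulrC (sinn n y) _)).
  by rewrite !rintZ// rint_cosn rint_sinn mulr0 addr0 [X in _ * X]mulrC.
case: N N0 => // N _.
rewrite (bigD1 ord0)//= big1 ?addr0 => [|n n0]; last first.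
  by rewrite E (_ : (n == 0 :> nat)%N = false) ?mul0r ?mulr0//; exact: negbTE.
rewrite E mul1r; congr (_ * _); apply: eq_rint => y _.
by rewrite cosn0 mulr1.
Qed.

(** * Ingredients of the Korovkin estimate *)

Lemma uniform_continuity h (e : R) : continuous h -> 0 < e ->
  exists2 d : R, 0 < d & forall x y, 0 <= x <= 1 -> `|x - y| < d -> `|h x - h y| < e.
Proof.
move=> ch e0; have e20 : 0 < e / 2 by rewrite divr_gt0.
have /compact_near_coveringP/(_ R (0^'+)
   (fun d x => forall y, `|x - y| < d -> `|h x - h y| < e)) := @segment_compact R 0 1.
case.
  move=> x _; have := ch x => /cvgrPdist_lt /(_ _ e20) /nbhs_ballP[r /= r0 hr].
  exists (ball x (r / 2), [set d | d < r / 2]).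
    split => /=; first by apply: nbhsx_ballx; rewrite divr_gt0.
    by apply: nbhs_right_lt; rewrite divr_gt0.
  move=> [z d] /= [xz dr] y zy.
  have h1 : `|h x - h z| < e / 2.
    by apply: hr; apply: lt_trans xz _; lra.
  have h2 : `|h x - h y| < e / 2.
    apply: hr; rewrite /ball /= -(subrKA z) (le_lt_trans (ler_normD _ _))//.
    move: xz; rewrite /ball /= => xz; lra.
  rewrite -(subrKA (h x)) (le_lt_trans (ler_normD _ _))// distrC; lra.
(* Here [d] is the radius of a right neighbourhood of 0 in which every admissible distance works;
   [d / 2] lies inside it. *)
move=> d /= d0 hd; exists (d / 2); first by rewrite divr_gt0.
have := hd (d / 2); rewrite /ball /= sub0r normrN gtr0_norm ?divr_gt0// => H x y x01.
by apply: H => //; rewrite ltr_pdivrMr// ltr_pMr// ltr1n.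
Qed.

(** The map t -> 1 - t preserves the cosine, so t <= 1/2 may be assumed, and there the cosine
    decreases. *)
Lemma cos_le_far (d t : R) : 0 < d -> d <= t <= 1 - d -> cosn 1 t <= cosn 1 d.
Proof.
move=> d0; wlog t2 : t / t <= 2^-1.
  move=> W /andP[dt td]; have [t2|t2] := leP t 2^-1; first by apply: W; rewrite ?dt.
  rewrite -(cosnN 1 t) -cosn_periodic; apply: W; first lra.
  by apply/andP; split; lra.
move=> /andP[dt _]; have pi0 := pi_gt0 R.
rewrite /cosn mulr1; have [->//|dt'] := eqVneq d t.
have lt : d < t by rewrite lt_neqAle dt'.
apply: ltW; rewrite ltr_cos.
- by rewrite ltr_pM2l// mulr_gt0.
- by rewrite in_itv /=; apply/andP; split; nra.
- by rewrite in_itv /=; apply/andP; split; nra.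
Qed.

Lemma cosn1_lt1 (d : R) : 0 < d < 2^-1 -> cosn 1 d < 1.
Proof.
move=> /andP[d0 d2]; have pi0 := pi_gt0 R.
rewrite -[ltRHS]cos0 /cosn mulr1 ltr_cos.
- by rewrite mulr_gt0// mulr_gt0.
- by rewrite in_itv /= lexx ltW.
- by rewrite in_itv /=; apply/andP; split; nra.
Qed.

(** The sum of the indicators of [0, d[ and ]1 - d, 1[. It pays for pairs x, y that are close on the
    circle but at opposite ends of [0, 1[, at a price 2d that is small in the mean. *)
Lemma edge_function (d : R) : 0 < d < 2^-1 ->
  exists f : R -> R, [/\ Lint f, forall x, 0 <= f x,
    forall x, I x -> x < d \/ 1 - d < x -> 1 <= f x & rint f = 2 * d].
Proof.
move=> /andP[d0 d2].
pose A : set R := `[0, d[%classic; pose B : set R := `]1 - d, 1[%classic.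
have mA : measurable (A : set (measurableTypeR R)) by exact: measurable_itv.
have mB : measurable (B : set (measurableTypeR R)) by exact: measurable_itv.
have int C : measurable (C : set (measurableTypeR R)) -> C `<=` I ->
    Lint (\1_C) /\ rint (\1_C) = fine (mu C).
  move=> mC CI; split.
    apply: measurable_bounded_integrable.
    - exact: measurable_I01.
    - have muI : (mu I < +oo)%E by rewrite lebesgue_I01 ltry.
      exact: muI.
    - by apply: measurable_indic.
    - exists 1; split => // y y1 x _; rewrite /= indicE.
      by case: (_ \in _); rewrite ?normr1 ?normr0 ltW// (lt_trans _ y1).
  rewrite /rint /Rintegral integral_indic//; last exact: measurable_I01.
  by congr (fine (mu _)); apply/setIidPl.
have AI : A `<=` I.
  by move=> x; rewrite /A /= in_itv /= => /andP[x0 xd]; apply/I01E/andP; split=> //; lra.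
have BI : B `<=` I.
  by move=> x; rewrite /B /= in_itv /= => /andP[x0 xd]; apply/I01E/andP; split=> //; lra.
have [iA rA] := int A mA AI; have [iB rB] := int B mB BI.
exists (fun x => \1_A x + \1_B x); split.
- exact: LintD.
- by move=> x; rewrite !indicE addr_ge0.
- move=> x /I01E /andP[x0 x1] [xd|xd].
    by rewrite !indicE mem_set ?lerDl// /A /= in_itv /= x0.
  have xB : B x by rewrite /B /= in_itv /= xd.
  by rewrite !indicE (mem_set xB) lerDr.
- rewrite rintD// rA rB /A /B !lebesgue_measure_itv /= !lte_fin.
  rewrite d0 ifT; last lra.
  by rewrite -!EFinB /=; ring.
Qed.

End Korovkin.

(** * Convergence in L^1 of convolutions with the squared Fejer kernel *)

Section Approximation.
Variable R : realType.
Notation mu := (@lebesgue_measure R).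
Notation I := (@I01 R).
Implicit Types (h g : R -> R) (x y : R).
Local Notation cosn := (@cosn R).

Lemma continuous_density h (e : R) : Lint h -> 0 < e ->
  exists2 g, continuous g & rint (fun x => `|h x - g x|) < e.
Proof.
move=> ih e0.
have muI : (mu I < +oo)%E by rewrite lebesgue_I01 ltry.
have [g_ [cg _]] := approximation_continuous_integrable (@measurable_I01 R) muI ih.
move=> /fine_cvgP[_ /cvgrPdist_lt /(_ _ e0)] [n _ /(_ n (leqnn n))] /=.
rewrite sub0r normrN => hn; exists (g_ n); first exact: cg.
by apply: le_lt_trans hn; rewrite ler_norm.
Qed.

(* Korovkin: a translation of a continuous function is controlled by the
   single test function [1 - cos], except that [g] need not be 1-periodic, so
   points near the ends of [0, 1[ are handled by [f]. *)
Lemma korovkin_bound g (M e d : R) (f : R -> R) :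
  0 < d < 2^-1 -> 0 < e -> 0 <= M -> (forall x, 0 <= x <= 1 -> `|g x| <= M) ->
  (forall x y, 0 <= x <= 1 -> `|x - y| < d -> `|g x - g y| < e) ->
  (forall x, 0 <= f x) -> (forall x, I x -> x < d \/ 1 - d < x -> 1 <= f x) ->
  forall x y, I x -> I y -> `|g y - g x| <=
    e + 2 * M / (1 - cosn 1 d) * (1 - cosn 1 (x - y)) + 2 * M * f x.
Proof.
move=> d01 e0 M0 gM gd f0 f1 x y Ix Iy.
have [/andP[x0 x1] /andP[y0 y1]] : 0 <= x < 1 /\ 0 <= y < 1.
  by split; apply/I01E.
have g2M : `|g y - g x| <= 2 * M.
  rewrite (le_trans (ler_normB _ _))// mulr2n mulrDl !mul1r lerD// gM//.
    by rewrite y0 ltW.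
  by rewrite x0 ltW.
have c0 : 0 < 1 - cosn 1 d by rewrite subr_gt0 cosn1_lt1.
have t0 : 0 <= 1 - cosn 1 (x - y) by rewrite subr_ge0 cos_le1.
have A0 : 0 <= 2 * M / (1 - cosn 1 d) by rewrite divr_ge0 ?mulr_ge0// ltW.
have P1 := mulr_ge0 A0 t0.
have P2 : 0 <= 2 * M * f x by rewrite !mulr_ge0.
(* Three regimes: close points use uniform continuity, distances in [d, 1 - d] use the test function
   1 - cos, and larger distances force x to within d of an end, where [f x >= 1]. *)
have [xy|xy] := ltP `|x - y| d.
  have : `|g y - g x| < e by rewrite distrC; apply: gd => //; rewrite x0 ltW.
  lra.
have /andP[d0 d2] := d01.
have [xy'|xy'] := leP `|x - y| (1 - d).
  have : cosn 1 (x - y) <= cosn 1 d.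
    have -> : cosn 1 (x - y) = cosn 1 `|x - y|.
      by case: (ger0P (x - y)) => // _; rewrite cosnN.
    by apply: cos_le_far => //; rewrite xy.
  move=> cc; have : 2 * M <= 2 * M / (1 - cosn 1 d) * (1 - cosn 1 (x - y)).
    rewrite -mulrA ler_peMr ?mulr_ge0// ler_pdivlMl//; lra.
  lra.
have : 1 <= f x.
  apply: f1 => //; move: xy'; case: (ger0P (x - y)) => _ H; [right|left]; lra.
move=> fx; have : 2 * M <= 2 * M * f x by rewrite ler_peMr// mulr_ge0.
lra.
Qed.

(** With g continuous and close to h, the error splits into (h - g) * K, the Korovkin term for g,
    and g - h. The first has norm at most that of h - g, since K is nonnegative of mass 1. *)
Lemma korovkin_L1 h (e : R) : Lint h -> 0 < e ->
  exists N0 : nat, forall N, (N0 <= N)%N ->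
    rint (fun x => `|rint (fun y => h y * trig N (fejer_sqc R N) (x - y)) - h x|) < e.
Proof.
(* Five contributions of size at most s are added at the end, so e / 8 leaves room. *)
move=> ih e0; pose s := e / 8; have s0 : 0 < s by rewrite divr_gt0.
have [g cg hg] := continuous_density ih s0.
have [M M0 gM] := continuous_bounded cg.
have [d1 d10 gd1] := uniform_continuity cg s0.
(* The bound 1/4 keeps d below 1/2, and the last bound makes the edge term 2M . 2d at most s; the
   added 1 avoids division by zero when M = 0. *)
pose d := Num.min (Num.min d1 4^-1) (s / (4 * M + 1)).
have M1 : 0 < 4 * M + 1 by rewrite ltr_wpDl// mulr_ge0.
have d0 : 0 < d by rewrite !lt_min d10 divr_gt0// invr_gt0 ltr0n.
have dd1 : d <= d1 by rewrite /d !ge_min lexx.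
have d4 : d <= 4^-1 by rewrite /d !ge_min lexx orbT.
have dM : 4 * M * d <= s.
  have : d <= s / (4 * M + 1) by rewrite /d ge_min lexx orbT.
  rewrite ler_pdivlMr// => H; nra.
have d01 : 0 < d < 2^-1 by apply/andP; split => //; lra.
have gd x y : 0 <= x <= 1 -> `|x - y| < d -> `|g x - g y| < s.
  by move=> x01 xy; apply: gd1 => //; exact: lt_le_trans dd1.
have [f [fi f0 f1 rf]] := edge_function d01.
have KB := korovkin_bound d01 s0 M0 gM gd f0 f1.
set A := 2 * M / (1 - cosn 1 d) in KB.
have A0 : 0 <= A.
  by rewrite divr_ge0 ?mulr_ge0// ltW// subr_gt0 cosn1_lt1.
(* N >= 2 makes frequency 1 present in the kernel; the other bound gives A . 2/N <= s. *)
exists (maxn 2 (Num.truncn (A * 2 / s)).+1) => N; rewrite geq_max => /andP[N2 NA].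
have N0 : (0 < N)%N by case: N N2 NA.
have NR : 0 < N%:R :> R by rewrite ltr0n.
have AN : A * (2 / N%:R) <= s.
  rewrite mulrA ler_pdivrMr// -ler_pdivrMl// mulrC ltW//.
  by rewrite (lt_le_trans (truncnS_gt _))// ler_nat.
set K := trig N (fejer_sqc R N).
have K0 x : 0 <= K x by exact: fejer_sqc_ge0.
have cK x : continuous (fun y => K (x - y)).
  by apply: continuous_comp_sub; exact: continuous_trig.
have K1 x : rint (fun y => K (x - y)) = 1 by rewrite rint_trig_sub// fejer_sqc0.
have iK x : Lint (fun y => K (x - y)) by exact: Lint_continuous.
have ig : Lint g by exact: Lint_continuous.
have ir : Lint (fun x => h x - g x) by exact: LintB.
have ir' : Lint (fun x => `|h x - g x|) by exact: Lint_norm.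
have cC x : continuous (fun y => cosn 1 (x - y)).
  by apply: continuous_comp_sub; exact: continuous_cosn.
pose T x := rint (fun y => `|h y - g y| * K (x - y)).
have iT : Lint T by apply: Lint_continuous; exact: continuous_conv_trig.
have rT : rint T = rint (fun x => `|h x - g x|).
  by rewrite /T rint_rint_conv_trig// fejer_sqc0 mul1r.
(* The pointwise bound of [korovkin_bound] integrated in y against K(x - y). *)
pose Bd x := s + A * (1 - fejer_sqc R N 1 / 2) + 2 * M * f x.
have mid x : I x -> `|rint (fun y => (g y - g x) * K (x - y))| <= Bd x.
  move=> Ix.
  have cg' : continuous (fun y => g y - g x).
    by move=> y; apply: cvgB; [exact: cg|exact: cvg_cst].
  have i1 : Lint (fun y => (g y - g x) * K (x - y)).
    by apply: LintM => //; exact: Lint_continuous.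
  apply: (le_trans (le_norm_rint i1)).
  have i2 : Lint (fun y => cosn 1 (x - y) * K (x - y)).
    by apply: LintM => //; exact: Lint_continuous.
  have i3 : Lint (fun y => A * (K (x - y) - cosn 1 (x - y) * K (x - y))).
    by apply: LintZ; exact: LintB.
  have i4 : Lint (fun y => (s + 2 * M * f x) * K (x - y)) by exact: LintZ.
  have -> : Bd x = rint (fun y => (s + 2 * M * f x) * K (x - y) +
      A * (K (x - y) - cosn 1 (x - y) * K (x - y))).
    rewrite rintD// !rintZ//; last exact: LintB.
    by rewrite rintB// K1 rint_cosn_trig_sub// /Bd; ring.
  apply: le_rint => [||y Iy].
  - exact: Lint_norm.
  - exact: LintD.
  - rewrite normrM (ger0_norm (K0 _)).
    have := ler_wpM2r (K0 (x - y)) (KB x y Ix Iy); rewrite -/A; lra.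
have iBd : Lint Bd.
  by apply: LintD; [exact: Lint_cst|exact: LintZ].
have iL : Lint (fun x => rint (fun y => h y * K (x - y))).
  by apply: Lint_continuous; exact: continuous_conv_trig.
apply: (@le_lt_trans _ _ (rint (fun x => T x + Bd x + `|h x - g x|))).
  apply: le_rint => [||x Ix].
  - by apply: Lint_norm; exact: LintB.
  - by apply: LintD => //; exact: LintD.
  - have -> : rint (fun y => h y * K (x - y)) - h x =
       rint (fun y => (h y - g y) * K (x - y)) +
       rint (fun y => (g y - g x) * K (x - y)) - (h x - g x).
      have i1 : Lint (fun y => (h y - g y) * K (x - y)) by exact: LintM.
      have i2 : Lint (fun y => g y * K (x - y)) by exact: LintM.
      have i3 : Lint (fun y => g x * K (x - y)) by exact: LintZ.
      have -> : rint (fun y => (g y - g x) * K (x - y)) =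
                rint (fun y => g y * K (x - y)) - g x.
        rewrite -[in RHS](mulr1 (g x)) -[in RHS](K1 x) -rintZ// -rintB//.
        by apply: eq_rint => y _; ring.
      have -> : rint (fun y => h y * K (x - y)) =
          rint (fun y => (h y - g y) * K (x - y)) + rint (fun y => g y * K (x - y)).
        by rewrite -rintD//; apply: eq_rint => y _; ring.
      ring.
    rewrite (le_trans (ler_normB _ _))// lerD2r (le_trans (ler_normD _ _))//.
    apply: lerD; last exact: mid.
    have i1 : Lint (fun y => (h y - g y) * K (x - y)) by exact: LintM.
    apply: (le_trans (le_norm_rint i1)); rewrite /T le_eqVlt; apply/orP; left.
    by apply/eqP/eq_rint => y _; rewrite normrM (ger0_norm (K0 _)).
have iTB : Lint (fun x => T x + Bd x) by exact: LintD.
rewrite rintD// rintD// rT /Bd rintD ?rint_cst ?rintZ ?rf//; last 2 first.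
- exact: Lint_cst.
- exact: LintZ.
have J1 : A * (1 - fejer_sqc R N 1 / 2) <= s.
  by rewrite (le_trans _ AN)// ler_wpM2l// fejer_sqc1.
move: hg J1 dM; rewrite /s; lra.
Qed.

End Approximation.

(** * Complex-valued integrals *)

Section ComplexIntegrals.
Variable R : realType.
Notation mu := (@lebesgue_measure R).
Notation I := (@I01 R).
Local Open Scope complex_scope.
Implicit Types (h : R -> R[i]) (k : R -> R) (z : R[i]) (f g : fnG R) (x y : R).

Definition Lc h := Lint (fun x => complex.Re (h x)) /\ Lint (fun x => complex.Im (h x)).

Lemma eq_complexP z w :
  complex.Re z = complex.Re w -> complex.Im z = complex.Im w -> z = w.
Proof. by case: z w => [a b] [c d] /= -> ->. Qed.

Lemma cReM z w : complex.Re (z * w) =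
  complex.Re z * complex.Re w - complex.Im z * complex.Im w.
Proof. by case: z w => [a b] [c d]. Qed.

Lemma cImM z w : complex.Im (z * w) =
  complex.Re z * complex.Im w + complex.Im z * complex.Re w.
Proof. by case: z w => [a b] [c d]. Qed.

Lemma cReD z w : complex.Re (z + w) = complex.Re z + complex.Re w.
Proof. by case: z w => [a b] [c d]. Qed.

Lemma cImD z w : complex.Im (z + w) = complex.Im z + complex.Im w.
Proof. by case: z w => [a b] [c d]. Qed.

Lemma cReB z w : complex.Re (z - w) = complex.Re z - complex.Re w.
Proof. by case: z w => [a b] [c d]. Qed.

Lemma cImB z w : complex.Im (z - w) = complex.Im z - complex.Im w.
Proof. by case: z w => [a b] [c d]. Qed.

Definition cplxE := (cReD, cImD, cReB, cImB, cReM, cImM).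

Lemma eq_Lc h h' : h =1 h' -> Lc h -> Lc h'.
Proof. by move=> /funext ->. Qed.

Lemma LcZ z h : Lc h -> Lc (fun x => z * h x).
Proof.
move=> [ir ii]; split.
  under eq_fun do rewrite cReM.
  by apply: LintB; exact: LintZ.
under eq_fun do rewrite cImM.
by apply: LintD; exact: LintZ.
Qed.

Lemma LcD h h' : Lc h -> Lc h' -> Lc (fun x => h x + h' x).
Proof.
move=> [ir ii] [ir' ii']; split.
  by under eq_fun do rewrite cReD; exact: LintD.
by under eq_fun do rewrite cImD; exact: LintD.
Qed.

Lemma LcM h k : Lc h -> continuous k -> Lc (fun x => h x * (k x)%:C).
Proof.
move=> [ir ii] ck; split.
  under eq_fun do rewrite cReM /= mulr0 subr0; exact: LintM.
under eq_fun do rewrite cImM /= mulr0 add0r; exact: LintM.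
Qed.

Lemma Lc_real k : Lint k -> Lc (fun x => (k x)%:C).
Proof. by move=> ik; split => //=; exact: Lint_cst. Qed.

Lemma Lc_cst z : Lc (fun=> z).
Proof. by split; exact: Lint_cst. Qed.

Lemma Lc_sum (T : Type) (s : seq T) (F : T -> R -> R[i]) :
  (forall i, Lc (F i)) -> Lc (fun x => \sum_(i <- s) F i x).
Proof.
move=> iF; elim: s => [|i s IH].
  by apply: (eq_Lc _ (Lc_cst 0)) => x; rewrite big_nil.
by apply: (eq_Lc _ (LcD (iF i) IH)) => x; rewrite big_cons.
Qed.

Lemma cintD h h' : Lc h -> Lc h' -> cint (fun x => h x + h' x) = cint h + cint h'.
Proof.
move=> [ir ii] [ir' ii']; apply: eq_complexP; rewrite cplxE /=.
  by under eq_fun do rewrite cReD; rewrite rintD.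
by under eq_fun do rewrite cImD; rewrite rintD.
Qed.

Lemma cintZ z h : Lc h -> cint (fun x => z * h x) = z * cint h.
Proof.
move=> [ir ii]; apply: eq_complexP; rewrite cplxE /=.
  under eq_fun do rewrite cReM.
  by rewrite rintB ?rintZ//; exact: LintZ.
under eq_fun do rewrite cImM.
by rewrite rintD ?rintZ//; exact: LintZ.
Qed.

Lemma cint_sum (T : Type) (s : seq T) (F : T -> R -> R[i]) :
  (forall i, Lc (F i)) ->
  cint (fun x => \sum_(i <- s) F i x) = \sum_(i <- s) cint (F i).
Proof.
move=> iF; elim: s => [|i s IH].
  rewrite big_nil; apply: eq_complexP => /=; rewrite -[RHS](rint_cst 0);
    by apply: eq_rint => x _; rewrite big_nil.
rewrite big_cons -IH -cintD//; last exact: Lc_sum.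
by congr cint; apply/funext => x; rewrite big_cons.
Qed.

Lemma cint_real k : cint (fun x => (k x)%:C) = (rint k)%:C.
Proof. by apply: eq_complexP => //=; rewrite rint_cst. Qed.

Lemma cint_cst z : cint (fun=> z) = z.
Proof. by apply: eq_complexP => /=; rewrite rint_cst. Qed.

Lemma cint_fr h (s : bool) x : Lc h ->
  cint (fun y => h (fr (sgnb R s * (x - y)))) = cint h.
Proof.
move=> [/Lint_measurable mr /Lint_measurable mi].
by apply: eq_complexP => /=; [rewrite (rint_fr s x mr)|rewrite (rint_fr s x mi)].
Qed.

Lemma cabs_ge0 z : 0 <= cabs z.
Proof. exact: sqrtr_ge0. Qed.

Lemma cabsM z w : cabs (z * w) = cabs z * cabs w.
Proof.
rewrite /cabs -sqrtrM ?addr_ge0 ?sqr_ge0// !cplxE; congr Num.sqrt; ring.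
Qed.

Lemma cabs_real x : cabs x%:C = `|x|.
Proof. by rewrite /cabs /= expr0n addr0 sqrtr_sqr. Qed.

Lemma cabs_eq0 z : cabs z = 0 -> z = 0.
Proof.
move=> /eqP; rewrite /cabs sqrtr_eq0 => H.
have [r0 i0] : complex.Re z ^+ 2 = 0 /\ complex.Im z ^+ 2 = 0.
  have := sqr_ge0 (complex.Re z); have := sqr_ge0 (complex.Im z); split; lra.
by apply: eq_complexP => /=; apply/eqP; rewrite -sqrf_eq0; apply/eqP.
Qed.

Lemma cabs_le z : cabs z <= `|complex.Re z| + `|complex.Im z|.
Proof.
rewrite -[leRHS]ger0_norm ?addr_ge0// -sqrtr_sqr ler_wsqrtr//.
rewrite sqrrD !real_normK ?num_real//.
have := mulr_ge0 (normr_ge0 (complex.Re z)) (normr_ge0 (complex.Im z)); lra.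
Qed.

Lemma Re_le_cabs z : `|complex.Re z| <= cabs z.
Proof. by rewrite -sqrtr_sqr ler_wsqrtr// lerDl sqr_ge0. Qed.

Lemma Im_le_cabs z : `|complex.Im z| <= cabs z.
Proof. by rewrite -sqrtr_sqr ler_wsqrtr// lerDr sqr_ge0. Qed.

Lemma measurable_cabs h : measurable_fun I (fun x => complex.Re (h x)) ->
  measurable_fun I (fun x => complex.Im (h x)) ->
  measurable_fun I (fun x => cabs (h x)).
Proof.
move=> mr mi; apply: (@measurableT_comp _ _ _ _ _ _ (@Num.sqrt R)).
  by apply: continuous_measurable_fun; exact: sqrt_continuous.
by apply: measurable_funD; exact: measurable_funX.
Qed.

Lemma Lint_cabs h : Lc h -> Lint (fun x => cabs (h x)).
Proof.
move=> [ir ii]; have := LintD (Lint_norm ir) (Lint_norm ii).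
apply: le_integrable; first exact: measurable_I01.
  apply/measurable_EFinP; apply: measurable_cabs; exact: Lint_measurable.
move=> x _; rewrite /= lee_fin ger0_norm ?cabs_ge0//.
by rewrite (le_trans (cabs_le _))// ler_norm.
Qed.

Lemma half_lty (X : \bar R) : ((2^-1)%:E * X < +oo)%E -> (X < +oo)%E.
Proof.
case: X => [r _| |//]; first exact: ltry.
by rewrite gt0_muley// lte_fin invr_gt0.
Qed.

(** Finiteness of the sum of two nonnegative integrals bounds each coset separately, and the modulus
    dominates real and imaginary parts. *)
Lemma inL1P f : inL1 f <-> forall a, Lc (f ^~ a).
Proof.
split=> [[mf nf] a|Lf].
  have int_lty b : (\int[mu]_(t in I) (cabs (f t b))%:E < +oo)%E.
    have p0 c : (0 <= \int[mu]_(t in I) (cabs (f t c))%:E)%E.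
      by apply: integral_ge0 => t _; rewrite lee_fin cabs_ge0.
    have := half_lty nf; apply: le_lt_trans.
    by case: b; [exact: leeDl|exact: leeDr].
  have [mr mi] := mf a.
  have icabs : Lint (fun t => cabs (f t a)).
    apply/integrableP; split; first by apply/measurable_EFinP; exact: measurable_cabs.
    apply: le_lt_trans (int_lty a); rewrite le_eqVlt; apply/orP; left.
    by apply/eqP/eq_integral => t _; rewrite /= ger0_norm ?cabs_ge0.
  split.
  - apply: le_integrable icabs; [exact: measurable_I01|exact/measurable_EFinP|].
    by move=> t _; rewrite /= lee_fin (ger0_norm (cabs_ge0 _)) Re_le_cabs.
  - apply: le_integrable icabs; [exact: measurable_I01|exact/measurable_EFinP|].
    by move=> t _; rewrite /= lee_fin (ger0_norm (cabs_ge0 _)) Im_le_cabs.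
split=> [a|]; first by have [/Lint_measurable ? /Lint_measurable ?] := Lf a.
rewrite /nrm (integral_rint (Lint_cabs (Lf true))).
by rewrite (integral_rint (Lint_cabs (Lf false))) -EFinD -EFinM ltry.
Qed.

Lemma nrmE f : inL1 f -> nrm f =
  (2^-1 * (rint (fun x => cabs (f x true)) + rint (fun x => cabs (f x false))))%:E.
Proof.
move=> /inL1P Lf; rewrite /nrm (integral_rint (Lint_cabs (Lf true))).
by rewrite (integral_rint (Lint_cabs (Lf false))) -EFinD -EFinM.
Qed.

Lemma nrm0 f : (forall x a, f x a = 0) -> nrm f = 0%E.
Proof.
move=> f0; rewrite nrmE; last first.
  by apply/inL1P => a; apply: (eq_Lc _ (Lc_cst 0)) => x; rewrite f0.
have c0 a : rint (fun x => cabs (f x a)) = 0.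
  rewrite -[RHS](rint_cst 0); apply: eq_rint => x _.
  by rewrite f0 cabs_real normr0.
by rewrite !c0 addr0 mulr0.
Qed.

End ComplexIntegrals.

(** * Convolution with trigonometric polynomials *)

Section Convolution.
Variable R : realType.
Notation I := (@I01 R).
Local Open Scope complex_scope.
Implicit Types (h u : R -> R[i]) (k : R -> R) (z c : R[i]) (b : nat -> R[i]).
Implicit Types (f g : fnG R) (x y : R) (s : bool).
Local Notation cosn := (@cosn R).
Local Notation sinn := (@sinn R).
Local Notation conv := (@Defs.conv R).

Lemma conv_true f g x : conv f g x true = (2^-1)%:C *
  (cint (fun y => f y true * g (fr (sgnb R true * (x - y))) true) +
   cint (fun y => f y false * g (fr (sgnb R false * (x - y))) false)).
Proof. by []. Qed.

Lemma conv_false f g x : conv f g x false = (2^-1)%:C *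
  (cint (fun y => f y true * g (fr (sgnb R true * (x - y))) false) +
   cint (fun y => f y false * g (fr (sgnb R false * (x - y))) true)).
Proof. by []. Qed.

Lemma eq_cint h h' : h =1 h' -> cint h = cint h'.
Proof. by move=> /funext ->. Qed.

(** The substitution z = s(x - y) on the circle; as s = 1 or -1 is its own inverse, y equals x - s z
    up to an integer, which the period of [u] absorbs. *)
Lemma cint_periodicM u h s x : (forall y, u (y + 1) = u y) ->
  Lc (fun y => u (x - sgnb R s * y) * h y) ->
  cint (fun y => u y * h (fr (sgnb R s * (x - y)))) =
  cint (fun y => u (x - sgnb R s * y) * h y).
Proof.
move=> u1 iuh; rewrite -[RHS](cint_fr s x iuh); apply: eq_cint => y /=.
congr (_ * _); rewrite /fr; set n := Num.floor _.
case: s {iuh} @n => n; rewrite /sgnb.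
  by rewrite -(periodic_intr u1 n y); congr u; ring.
by rewrite -(periodic_intr u1 (- n) y); congr u; rewrite mulrNz; ring.
Qed.

Definition ctrig (N : nat) b x : R[i] := \sum_(n < N) b n * (cosn n x)%:C.

Definition fcos f (a : bool) (n : nat) : R[i] := cint (fun y => f y a * (cosn n y)%:C).
Definition fsin f (a : bool) (n : nat) : R[i] := cint (fun y => f y a * (sinn n y)%:C).

Lemma ctrig_periodic N b x : ctrig N b (x + 1) = ctrig N b x.
Proof. by apply: eq_bigr => n _; rewrite cosn_periodic. Qed.

Lemma ctrigN N b x : ctrig N b (- x) = ctrig N b x.
Proof. by apply: eq_bigr => n _; rewrite cosnN. Qed.

Lemma ctrig_fr N b x : ctrig N b (fr x) = ctrig N b x.
Proof. exact: (periodic_fr (ctrig_periodic N b)). Qed.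

Lemma Lc_ctrigM N b h x : Lc h -> Lc (fun y => h y * ctrig N b (x - y)).
Proof.
move=> ih; apply: (@eq_Lc _ (fun y => \sum_(n < N) b n * (h y * (cosn n (x - y))%:C))).
  by move=> y; rewrite mulr_sumr; apply: eq_bigr => n _; ring.
apply: Lc_sum => n; apply: LcZ; apply: LcM => //.
by apply: continuous_comp_sub; exact: continuous_cosn.
Qed.

Lemma cint_ctrigM N b h x : Lc h -> cint (fun y => h y * ctrig N b (x - y)) =
  \sum_(n < N) b n * ((cosn n x)%:C * cint (fun y => h y * (cosn n y)%:C) +
                      (sinn n x)%:C * cint (fun y => h y * (sinn n y)%:C)).
Proof.
move=> ih.
have iC n : Lc (fun y => h y * (cosn n y)%:C) by apply: LcM => //; exact: continuous_cosn.
have iS n : Lc (fun y => h y * (sinn n y)%:C) by apply: LcM => //; exact: continuous_sinn.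
rewrite (@eq_cint _ (fun y => \sum_(n < N) b n * ((cosn n x)%:C * (h y * (cosn n y)%:C) +
    (sinn n x)%:C * (h y * (sinn n y)%:C)))); last first.
  move=> y; rewrite mulr_sumr; apply: eq_bigr => n _.
  by rewrite cosnB rmorphD !rmorphM /=; ring.
rewrite cint_sum => [|n]; last by apply: LcZ; apply: LcD; exact: LcZ.
apply: eq_bigr => n _; rewrite cintZ; last by apply: LcD; exact: LcZ.
by rewrite cintD ?cintZ//; exact: LcZ.
Qed.

(** All entries of the approximate diagonal have this shape, and convolution with a central function
    preserves it. *)
Definition Efun (N : nat) b c : fnG R := fun x a => if a then ctrig N b x else c.

Lemma Lc_ctrig N b : Lc (ctrig N b).
Proof.
apply: Lc_sum => n; apply: LcZ; apply: Lc_real; exact: Lint_cosn.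
Qed.

Lemma inL1_Efun N b c : inL1 (Efun N b c).
Proof. by apply/inL1P => -[]; [exact: Lc_ctrig|exact: Lc_cst]. Qed.

Lemma fcosE0 f a : fcos f a 0 = cint (f ^~ a).
Proof. by apply: eq_cint => y; rewrite cosn0 rmorph1 mulr1. Qed.

Lemma conv_Efun_true N b c f x : inL1 f -> conv f (Efun N b c) x true =
  (2^-1)%:C * (cint (fun y => f y true * ctrig N b (x - y)) + c * fcos f false 0).
Proof.
move=> /inL1P Lf; rewrite conv_true /Efun fcosE0 -(cintZ _ (Lf false)).
congr (_ * (cint _ + cint _)); apply/funext => y; last by rewrite mulrC.
by rewrite ctrig_fr /sgnb mul1r.
Qed.

Lemma conv_Efun_false N b c f x : inL1 f -> conv f (Efun N b c) x false =
  (2^-1)%:C * (c * fcos f true 0 + cint (fun y => f y false * ctrig N b (x - y))).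
Proof.
move=> /inL1P Lf; rewrite conv_false /Efun fcosE0 -(cintZ _ (Lf true)).
congr (_ * (cint _ + cint _)); apply/funext => y; first by rewrite mulrC.
by rewrite ctrig_fr /sgnb mulN1r ctrigN.
Qed.

(** Evenness of the cosine polynomial matters on the reflections, where one order of the product
    involves x - y and the other its opposite. The equality is pointwise. *)
Lemma Efun_central N b c f x a : inL1 f ->
  conv (Efun N b c) f x a = conv f (Efun N b c) x a.
Proof.
move=> Lf'; have /inL1P Lf := Lf'.
have A a' : cint (fun y => ctrig N b y * f (fr (sgnb R true * (x - y))) a') =
    cint (fun y => f y a' * ctrig N b (x - y)).
  rewrite (@cint_periodicM (ctrig N b) (f ^~ a')); [|exact: ctrig_periodic|].
    by apply: eq_cint => y; rewrite /sgnb mul1r mulrC.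
  apply: eq_Lc (Lc_ctrigM N b x (Lf a')) => y.
  by rewrite /sgnb mul1r mulrC.
have B a' : cint (fun y => c * f (fr (sgnb R false * (x - y))) a') =
    c * fcos f a' 0.
  rewrite fcosE0 -(cintZ _ (Lf a')) -(@cint_fr _ (fun y => c * f y a') false x)//.
  exact: LcZ (Lf a').
case: a.
  by rewrite conv_Efun_true// conv_true /Efun A B.
by rewrite conv_Efun_false// conv_false /Efun A B addrC.
Qed.

Lemma inZL1_Efun N b c : inZL1 (Efun N b c).
Proof.
split; first exact: inL1_Efun.
by move=> g Lg; apply: nrm0 => x a; rewrite /subG Efun_central// subrr.
Qed.

(** Since |sin| <= 1, |sin| dominates sin^2 = 1 - cos^2, whose integral is 1/2. *)
Lemma rint_norm_sinn (n : nat) : (0 < n)%N -> 0 < rint (fun x => `|sinn n x|).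
Proof.
move=> n0; apply: (@lt_le_trans _ _ 2^-1); first by rewrite invr_gt0.
have iC : Lint (fun x => cosn n x * cosn n x).
  by apply: LintM; [exact: Lint_cosn|exact: continuous_cosn].
have <- : rint (fun x => 1 - cosn n x * cosn n x) = 2^-1.
  rewrite rintB//; last exact: Lint_cst.
  by rewrite rint_cst rint_cosnM eqxx gtn_eqF//=; lra.
apply: le_rint => [||x _].
- by apply: LintB => //; exact: Lint_cst.
- by apply: Lint_norm; apply: Lint_continuous; exact: continuous_sinn.
- rewrite -expr2 -[1](cos2Dsin2 (2 * pi * n%:R * x)) -/(cosn n x) addrC addrA addNr add0r.
  rewrite -/(sinn n x) -real_normK ?num_real// expr2 ler_piMr//.
  exact: sin_max.
Qed.

(** Turns a commutator that vanishes almost everywhere into vanishing Fourier coefficients. *)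
Lemma nrm_sinn_eq0 (w : bool -> R[i]) (n : nat) : (0 < n)%N ->
  nrm (fun x a => w a * (sinn n x)%:C) = 0%E -> forall a, w a = 0.
Proof.
move=> n0; have iS : Lint (fun x => `|sinn n x|).
  by apply: Lint_norm; apply: Lint_continuous; exact: continuous_sinn.
have cw a : rint (fun x => cabs (w a * (sinn n x)%:C)) =
    cabs (w a) * rint (fun x => `|sinn n x|).
  by rewrite -rintZ//; apply: eq_rint => x _; rewrite cabsM cabs_real.
rewrite nrmE; last first.
  apply/inL1P => a; apply: LcZ; apply: Lc_real; apply: Lint_continuous.
  exact: continuous_sinn.
rewrite !cw => -[H] a; apply: cabs_eq0; have p0 := rint_norm_sinn n0.
have wt := mulr_ge0 (cabs_ge0 (w true)) (ltW p0).
have wf := mulr_ge0 (cabs_ge0 (w false)) (ltW p0).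
apply: (mulIf (lt0r_neq0 p0)); rewrite mul0r; move: H wt wf.
by case: a; lra.
Qed.

(** * Fourier coefficients of central functions, read off from test functions on the reflections *)

Section TestFunction.
Variable u : R -> R.
Hypotheses (cu : continuous u) (u1 : forall x, u (x + 1) = u x).

Definition test_fun : fnG R := fun x a => if a then 0 else (u x)%:C.

Lemma inL1_test_fun : inL1 test_fun.
Proof.
apply/inL1P => -[]; first exact: Lc_cst.
by apply: Lc_real; exact: Lint_continuous.
Qed.

(** A factor carried by the reflections exchanges the cosets, so the commutator on coset [a] sees
    [f] on the other one. *)
Lemma commutator_test_fun f x a : inL1 f ->
  subG (conv f test_fun) (conv test_fun f) x a =
  (2^-1)%:C * cint (fun y => f y (~~ a) *
     (u (if a then y - x else x - y) - u (x + y))%:C).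
Proof.
move=> /inL1P Lf.
have Cc h : cint (fun y => h y * 0) = 0.
  by rewrite (@eq_cint _ (fun=> 0)) ?cint_cst// => y; rewrite mulr0.
have Cc' h : cint (fun y => 0 * h y) = 0.
  by rewrite (@eq_cint _ (fun=> 0)) ?cint_cst// => y; rewrite mul0r.
have ufr y : u (fr y) = u y by exact: (periodic_fr u1).
have cuD : continuous (fun y => u (x + y)).
  move=> y; apply: continuous_comp; last exact: cu.
  by apply: cvgD; [exact: cvg_cst|exact: cvg_id].
have cuB : continuous (fun y => u (x - y)) by exact: continuous_comp_sub.
have cuB' : continuous (fun y => u (y - x)).
  move=> y; apply: continuous_comp; last exact: cu.
  by apply: cvgB; [exact: cvg_id|exact: cvg_cst].
have P a' : cint (fun y => (u y)%:C * f (fr (sgnb R false * (x - y))) a') =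
    cint (fun y => f y a' * (u (x + y))%:C).
  have E y : (u (x - sgnb R false * y))%:C * f y a' = f y a' * (u (x + y))%:C.
    by rewrite /sgnb mulN1r opprK mulrC.
  rewrite (@cint_periodicM (fun y => (u y)%:C) (f ^~ a')).
  - exact: eq_cint.
  - by move=> y; rewrite u1.
  - by apply: eq_Lc (LcM (Lf a') cuD) => y; rewrite E.
have D a' (v : R -> R) : continuous v ->
    cint (fun y => f y a' * (v y)%:C) - cint (fun y => f y a' * (u (x + y))%:C) =
    cint (fun y => f y a' * (v y - u (x + y))%:C).
  move=> cv; rewrite -[X in _ - X]mul1r -mulNr -cintZ; last exact: LcM.
  rewrite -cintD; [|exact: LcM|apply: LcZ; exact: LcM].
  by apply: eq_cint => y; rewrite rmorphB /=; ring.
rewrite /subG; case: a => /=.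
  rewrite !conv_true /test_fun Cc Cc' !add0r P -mulrBr -(D _ (fun y => u (y - x)))//.
  congr (_ * (cint _ - _)); apply/funext => y.
  by rewrite ufr /sgnb mulN1r opprB.
rewrite !conv_false /test_fun Cc Cc' add0r addr0 P -mulrBr -(D _ (fun y => u (x - y)))//.
congr (_ * (cint _ - _)); apply/funext => y.
by rewrite ufr /sgnb mul1r.
Qed.

End TestFunction.

(** Testing with u = cos: u(x - y) - u(x + y) = 2 sin x sin y, and evenness of u gives the same on
    both cosets. The commutator is thus a sine coefficient of f times sin x. *)
Lemma zl1_fsin f (a : bool) (n : nat) : inZL1 f -> fsin f a n = 0.
Proof.
move=> [L1f com]; case: n => [|n].
  by rewrite /fsin (@eq_cint _ (fun=> 0)) ?cint_cst// => y; rewrite sinn0 mulr0.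
have /inL1P Lf := L1f.
have E : subG (conv f (test_fun (cosn n.+1))) (conv (test_fun (cosn n.+1)) f) =
    fun x a => fsin f (~~ a) n.+1 * (sinn n.+1 x)%:C.
  apply/funext => x; apply/funext => b.
  rewrite commutator_test_fun//; [|exact: continuous_cosn|exact: cosn_periodic].
  have iS : Lc (fun y => f y (~~ b) * (sinn n.+1 y)%:C).
    by apply: LcM => //; exact: continuous_sinn.
  rewrite (@eq_cint _ (fun y => (2 * sinn n.+1 x)%:C * (f y (~~ b) * (sinn n.+1 y)%:C))).
    rewrite cintZ// mulrA -rmorphM /= mulrA mulVf// mul1r mulrC.
    by [].
  move=> y; rewrite mulrCA -rmorphM /=; congr (_ * _%:C).
  by case: b {iS}; rewrite cosnB cosnD; ring.
have := com _ (inL1_test_fun (@continuous_cosn R n.+1)).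
by rewrite E => /(nrm_sinn_eq0 (ltn0Sn n))/(_ (~~ a)); rewrite negbK.
Qed.

(** Testing with u = sin, the commutator on T is minus the wanted coefficient times sin x; on the
    reflections it is a sine coefficient, already zero. This is the Fourier form of being constant
    on the reflections. *)
Lemma zl1_fcos f (n : nat) : inZL1 f -> (0 < n)%N -> fcos f false n = 0.
Proof.
move=> Zf n0; have [L1f com] := Zf; have /inL1P Lf := L1f.
pose w (a : bool) : R[i] := if a then - fcos f false n else 0.
have E : subG (conv f (test_fun (sinn n))) (conv (test_fun (sinn n)) f) =
    fun x a => w a * (sinn n x)%:C.
  apply/funext => x; apply/funext => b.
  rewrite commutator_test_fun//; [|exact: continuous_sinn|exact: sinn_periodic].
  case: b => /=.
    have iC : Lc (fun y => f y false * (cosn n y)%:C).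
      by apply: LcM => //; exact: continuous_cosn.
    rewrite (@eq_cint _ (fun y => (- 2 * sinn n x)%:C * (f y false * (cosn n y)%:C))); last first.
      move=> y; rewrite sinnB sinnD mulrCA -rmorphM /=; congr (_ * _%:C); ring.
    rewrite cintZ// mulrA -rmorphM (_ : 2^-1 * _ = - sinn n x); last lra.
    by rewrite rmorphN /= !mulNr mulrC.
  have iS : Lc (fun y => f y true * (sinn n y)%:C).
    by apply: LcM => //; exact: continuous_sinn.
  rewrite (@eq_cint _ (fun y => (- 2 * cosn n x)%:C * (f y true * (sinn n y)%:C))); last first.
    move=> y; rewrite sinnB sinnD mulrCA -rmorphM /=; congr (_ * _%:C); ring.
  by rewrite cintZ// -/(fsin f true n) zl1_fsin// !mulr0 mul0r.
have := com _ (inL1_test_fun (@continuous_sinn R n)).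
rewrite E => /(nrm_sinn_eq0 n0)/(_ true) /= /eqP; rewrite oppr_eq0; exact: eqP.
Qed.

(** Vanishing sine coefficients keep the frequencies apart; frequency 0 and the constant on the
    reflections mix as in the group algebra of Z_2. *)
Lemma conv_zl1_Efun N b c f x a : (0 < N)%N -> inZL1 f ->
  conv f (Efun N b c) x a =
  Efun N (fun n => (2^-1)%:C * (b n * fcos f true n + (n == 0%N)%:R * (c * fcos f false 0)))
         ((2^-1)%:C * (c * fcos f true 0 + b 0%N * fcos f false 0)) x a.
Proof.
case: N => // N _ Zf; have [L1f _] := Zf; have /inL1P Lf := L1f.
case: a; rewrite ?conv_Efun_true ?conv_Efun_false// /Efun.
  rewrite cint_ctrigM// /ctrig.
  rewrite [RHS](eq_bigr (fun n : 'I_N.+1 => (2^-1)%:C * (b n * ((cosn n x)%:C * fcos f true n)) +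
      (2^-1)%:C * ((n == 0%N :> nat)%:R * (c * fcos f false 0)))); last first.
    move=> [n nN] _ /=; case: eqP => [->|_]; last by rewrite !mul0r; ring.
    by rewrite cosn0 rmorph1; ring.
  rewrite big_split /= -!mulr_sumr -mulrDr; congr (_ * (_ + _)).
    by apply: eq_bigr => n _; rewrite -/(fsin f true n) zl1_fsin// mulr0 addr0.
  by rewrite big_ord_recl mul1r big1 ?addr0// => n _; rewrite mul0r.
congr (_ * (_ + _)); rewrite cint_ctrigM// big_ord_recl big1 ?addr0.
  rewrite -/(fcos f false _) -/(fsin f false _) zl1_fsin//.
  by rewrite cosn0 rmorph1 mul1r mulr0 addr0.
move=> n _; rewrite -/(fcos f false _) -/(fsin f false _) zl1_fsin// zl1_fcos//.
by rewrite !mulr0 addr0 mulr0.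
Qed.

End Convolution.

(** * The approximate diagonal *)

Section ApproximateDiagonal.
Variable R : realType.
Notation mu := (@lebesgue_measure R).
Notation I := (@I01 R).
Local Open Scope complex_scope.
Implicit Types (f g : fnG R) (x y : R).
Local Notation cosn := (@cosn R).
Local Notation conv := (@Defs.conv R).

(** Real coefficients describe the diagonal itself, where positivity is used; complex ones appear
    after convolution with f. *)
Definition coef : Type := ((nat -> R) * R)%type.
Definition ccoef : Type := ((nat -> R[i]) * R[i])%type.

Definition ccoef_of (p : coef) : ccoef := (fun n => (p.1 n)%:C, p.2%:C).
Definition Ec (N : nat) (p : ccoef) : fnG R := Efun N p.1 p.2.

Definition delta0 (n : nat) : R := (n == 0%N)%:R.

(* A pair [(b, c)] stands for the function equal to the sum of the [b n * cosn n]
   on the circle and to [c] on the coset of reflections. *)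
Definition diag_coefs (N : nat) : seq (coef * coef) :=
  [seq ((fun n => 8 / N%:R * nodec R N j n, 0), (nodec R N j, 0)) | j <- iota 0 N]
  ++ [:: ((fun n => - 6 * delta0 n, 0), (delta0, 0)); ((fun=> 0, 2), (fun=> 0, 1))].

Definition diag (N : nat) : tens R :=
  [seq (Ec N (ccoef_of q.1), Ec N (ccoef_of q.2)) | q <- diag_coefs N].

Lemma sum_diag_coefs N (F : coef * coef -> R) :
  \sum_(q <- diag_coefs N) F q =
  \sum_(j < N) F ((fun n => 8 / N%:R * nodec R N j n, 0), (nodec R N j, 0)) +
  (F ((fun n => - 6 * delta0 n, 0), (delta0, 0)) + F ((fun=> 0, 2), (fun=> 0, 1))).
Proof.
rewrite /diag_coefs big_cat /= big_map !big_cons big_nil addr0; congr (_ + _).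
by rewrite -(big_mkord xpredT (fun j => F ((fun n => 8 / N%:R * nodec R N j n, 0),
  (nodec R N j, 0)))) /index_iota subn0.
Qed.

Lemma diag_moment_BB N (n k : nat) : (n < N)%N -> (k < N)%N ->
  \sum_(q <- diag_coefs N) q.1.1 n * q.2.1 k =
  (n == k)%:R * (if n == 0%N then 2 else 8 * fejer_sqc R N n).
Proof.
move=> nN kN; rewrite sum_diag_coefs /= mul0r addr0.
have -> : \sum_(j < N) 8 / N%:R * nodec R N j n * nodec R N j k =
    8 * (N%:R^-1 * \sum_(j < N) nodec R N j n * nodec R N j k).
  by rewrite !mulr_sumr; apply: eq_bigr => j _; ring.
rewrite sum_nodec// /delta0.
have [->|nk] := eqVneq n k.
  (* At frequency 0 the two contributions are 8 and -6, leaving the value 2 required by the Z_2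
     part. *)
  by case: (k =P 0%N) => [->|_]; rewrite ?fejer_sqc0 ?mulr1n ?mulr0n; ring.
case: (n =P 0%N) nk => [->|_] nk; last by rewrite !mulr0n; ring.
by rewrite [k == _]eq_sym (negbTE nk) !mulr0n; ring.
Qed.

Lemma diag_moment_BC N (n : nat) : \sum_(q <- diag_coefs N) q.1.1 n * q.2.2 = 0.
Proof.
by rewrite sum_diag_coefs /= big1 => [|j _]; rewrite ?mulr0 ?mul0r ?addr0.
Qed.

Lemma diag_moment_CB N (k : nat) : \sum_(q <- diag_coefs N) q.1.2 * q.2.1 k = 0.
Proof.
by rewrite sum_diag_coefs /= big1 => [|j _]; rewrite ?mulr0 ?mul0r ?addr0.
Qed.

Lemma diag_moment_CC N : \sum_(q <- diag_coefs N) q.1.2 * q.2.2 = 2.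
Proof.
rewrite sum_diag_coefs /= big1 => [|j _]; rewrite ?mulr0 ?mul0r ?addr0//.
by rewrite !add0r mulr1.
Qed.

Lemma sum_realC (T : Type) (s : seq T) (F G : T -> R) :
  \sum_(q <- s) (F q)%:C * (G q)%:C = (\sum_(q <- s) F q * G q)%:C.
Proof. by rewrite rmorph_sum; apply: eq_bigr => q _; rewrite rmorphM. Qed.

(** The kernel is bilinear in the coefficients, so equality of kernels reduces to four families of
    moments, one for each pair of cosets. *)
Lemma sum_Ec_eq (T : Type) (s : seq T) (N : nat) (A B A' B' : T -> ccoef) x a y b :
  (forall n k, (n < N)%N -> (k < N)%N ->
    \sum_(q <- s) (A q).1 n * (B q).1 k = \sum_(q <- s) (A' q).1 n * (B' q).1 k) ->
  (forall n, (n < N)%N ->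
    \sum_(q <- s) (A q).1 n * (B q).2 = \sum_(q <- s) (A' q).1 n * (B' q).2) ->
  (forall k, (k < N)%N ->
    \sum_(q <- s) (A q).2 * (B q).1 k = \sum_(q <- s) (A' q).2 * (B' q).1 k) ->
  \sum_(q <- s) (A q).2 * (B q).2 = \sum_(q <- s) (A' q).2 * (B' q).2 ->
  \sum_(q <- s) Ec N (A q) x a * Ec N (B q) y b =
  \sum_(q <- s) Ec N (A' q) x a * Ec N (B' q) y b.
Proof.
move=> hBB hBC hCB hCC; rewrite /Ec /Efun /ctrig; case: a; case: b => //.
- have E (U V : T -> ccoef) : \sum_(q <- s) (\sum_(n < N) (U q).1 n * (cosn n x)%:C) *
      (\sum_(n < N) (V q).1 n * (cosn n y)%:C) =
    \sum_(n < N) \sum_(k < N) (\sum_(q <- s) (U q).1 n * (V q).1 k) *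
      ((cosn n x)%:C * (cosn k y)%:C).
    under eq_bigr do rewrite mulr_suml.
    rewrite exchange_big; apply: eq_bigr => n _ /=.
    under eq_bigr do rewrite mulr_sumr.
    rewrite exchange_big; apply: eq_bigr => k _ /=.
    by rewrite mulr_suml; apply: eq_bigr => q _; ring.
  by rewrite !E; apply: eq_bigr => n _; apply: eq_bigr => k _; rewrite hBB.
- have E (U V : T -> ccoef) : \sum_(q <- s) (\sum_(n < N) (U q).1 n * (cosn n x)%:C) * (V q).2 =
    \sum_(n < N) (\sum_(q <- s) (U q).1 n * (V q).2) * (cosn n x)%:C.
    under eq_bigr do rewrite mulr_suml.
    rewrite exchange_big; apply: eq_bigr => n _ /=.
    by rewrite mulr_suml; apply: eq_bigr => q _; ring.
  by rewrite !E; apply: eq_bigr => n _; rewrite hBC.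
- have E (U V : T -> ccoef) : \sum_(q <- s) (U q).2 * (\sum_(n < N) (V q).1 n * (cosn n y)%:C) =
    \sum_(n < N) (\sum_(q <- s) (U q).2 * (V q).1 n) * (cosn n y)%:C.
    under eq_bigr do rewrite mulr_sumr.
    rewrite exchange_big; apply: eq_bigr => n _ /=.
    by rewrite mulr_suml; apply: eq_bigr => q _; ring.
  by rewrite !E; apply: eq_bigr => n _; rewrite hCB.
Qed.

(** * Exact commutation with central functions *)

Section Commutator.
Variables (N : nat) (f : fnG R).
Hypotheses (N0 : (0 < N)%N) (Zf : inZL1 f).
Let P := fcos f true.
Let Q := fcos f false 0.

Definition conv_coef (p : ccoef) : ccoef :=
  (fun n => (2^-1)%:C * (p.1 n * P n + (n == 0%N)%:R * (p.2 * Q)),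
   (2^-1)%:C * (p.2 * P 0%N + p.1 0%N * Q)).

(** On T x T the moments are diagonal, so multiplying by the n-th or the k-th coefficient of f is
    the same. On the mixed cosets both sides equal Q at frequency 0, because the T-moment there and
    the moment on the reflections are both 2. *)
Lemma diag_commutes x a y b :
  \sum_(q <- diag_coefs N)
    Ec N (conv_coef (ccoef_of q.1)) x a * Ec N (ccoef_of q.2) y b =
  \sum_(q <- diag_coefs N)
    Ec N (ccoef_of q.1) x a * Ec N (conv_coef (ccoef_of q.2)) y b.
Proof.
have mBB (n k : nat) := sum_realC (diag_coefs N)
  (fun q => q.1.1 n) (fun q => q.2.1 k).
have mBC (n : nat) := sum_realC (diag_coefs N) (fun q => q.1.1 n) (fun q => q.2.2).
have mCB (n : nat) := sum_realC (diag_coefs N) (fun q => q.1.2) (fun q => q.2.1 n).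
have mCC := sum_realC (diag_coefs N) (fun q => q.1.2) (fun q => q.2.2).
have L (v w u : coef * coef -> R[i]) (c d : R[i]) :
  \sum_(q <- diag_coefs N) ((2^-1)%:C * (v q * c + d * (w q * Q))) * u q =
  (2^-1)%:C * ((\sum_(q <- diag_coefs N) v q * u q) * c +
     d * ((\sum_(q <- diag_coefs N) w q * u q) * Q)).
  rewrite !mulr_suml !mulr_sumr -big_split mulr_sumr.
  by apply: eq_bigr => q _ /=; ring.
have L' (v w u : coef * coef -> R[i]) (c d : R[i]) :
  \sum_(q <- diag_coefs N) u q * ((2^-1)%:C * (v q * c + d * (w q * Q))) =
  (2^-1)%:C * ((\sum_(q <- diag_coefs N) u q * v q) * c +
     d * ((\sum_(q <- diag_coefs N) u q * w q) * Q)).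
  rewrite !mulr_suml !mulr_sumr -big_split mulr_sumr.
  by apply: eq_bigr => q _ /=; ring.
have L1 (v w u : coef * coef -> R[i]) (c : R[i]) :
  \sum_(q <- diag_coefs N) ((2^-1)%:C * (v q * c + w q * Q)) * u q =
  (2^-1)%:C * ((\sum_(q <- diag_coefs N) v q * u q) * c +
     (\sum_(q <- diag_coefs N) w q * u q) * Q).
  by rewrite -[X in _ + X]mul1r -L; apply: eq_bigr => q _; rewrite mul1r.
have L1' (v w u : coef * coef -> R[i]) (c : R[i]) :
  \sum_(q <- diag_coefs N) u q * ((2^-1)%:C * (v q * c + w q * Q)) =
  (2^-1)%:C * ((\sum_(q <- diag_coefs N) u q * v q) * c +
     (\sum_(q <- diag_coefs N) u q * w q) * Q).
  by rewrite -[X in _ + X]mul1r -L'; apply: eq_bigr => q _; rewrite mul1r.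
apply: sum_Ec_eq => [n k nN kN|n nN|k kN|] /=.
- rewrite L L' mBB mCB mBC diag_moment_BB// diag_moment_CB diag_moment_BC.
  by have [->//|_] := eqVneq n k; rewrite !mul0r !mulr0.
- rewrite L L1' mBB mBC mCC diag_moment_BB// diag_moment_CC diag_moment_BC.
  by have [->|_] := eqVneq n 0%N; rewrite !mul0r ?mul1r.
- rewrite L1 L' mBB mCB mCC diag_moment_BB// diag_moment_CB diag_moment_CC eq_sym.
  by have [->|_] := eqVneq k 0%N; rewrite !mul0r ?mul1r.
- by rewrite L1 L1' mCC mBC mCB diag_moment_BC diag_moment_CB.
Qed.

Lemma conv_Ec (p : ccoef) x a : conv f (Ec N p) x a = Ec N (conv_coef p) x a.
Proof. exact: conv_zl1_Efun. Qed.

Lemma kern_comm_act x a y b : kern (comm_act f (diag N)) x a y b = 0.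
Proof.
rewrite /kern /comm_act big_cat /= !big_map /=.
under eq_bigr do rewrite conv_Ec.
rewrite diag_commutes -big_split big1//= => q _.
(* [comm_act] multiplies the second factor by f on the right, [conv_coef] describes multiplication
   on the left; centrality identifies them. *)
by rewrite -conv_Ec /Ec Efun_central ?mulNr ?subrr//; case: Zf.
Qed.

Lemma projnorm_comm_act (e : R) : 0 < e -> projnorm_lt (comm_act f (diag N)) e.
Proof.
(* The kernel vanishes identically, so the empty tensor, of cost 0, represents the commutator. *)
move=> e0; exists [::]; split=> //; split; last by rewrite /cost big_nil lte_fin.
rewrite /tens_eq /nrm2 big1 ?mule0// => a _; rewrite big1// => b _.
rewrite integral0_eq// => x _; rewrite integral0_eq// => y _.
by rewrite kern_comm_act /kern big_nil subrr cabs_real normr0.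
Qed.

End Commutator.

(** * Product and cost of the diagonal *)

Lemma fcos_Efun_true N (b : nat -> R[i]) (c : R[i]) n : (n < N)%N ->
  fcos (Efun N b c) true n = b n * (if n == 0%N then 1 else 2^-1)%:C.
Proof.
move=> nN; rewrite /fcos /Efun.
have iC k : Lint (fun y => cosn k y * cosn n y).
  by apply: LintM; [exact: Lint_cosn|exact: continuous_cosn].
rewrite (@eq_cint _ _ (fun y => \sum_(k < N) b k * (cosn k y * cosn n y)%:C)); last first.
  by move=> y; rewrite mulr_suml; apply: eq_bigr => k _; rewrite rmorphM mulrA.
rewrite cint_sum => [|k]; last by apply: LcZ; exact: Lc_real.
rewrite (bigD1 (Ordinal nN))//= big1 ?addr0 => [|k kn].
  by rewrite cintZ ?cint_real ?rint_cosnM ?eqxx ?mul1r//; exact: Lc_real.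
rewrite cintZ ?cint_real ?rint_cosnM; last exact: Lc_real.
rewrite (_ : (k == n :> nat) = false) ?mul0r ?rmorph0 ?mulr0//.
exact: negbTE.
Qed.

Lemma fcos_Efun_false N (b : nat -> R[i]) (c : R[i]) : fcos (Efun N b c) false 0 = c.
Proof. by rewrite fcosE0 /Efun cint_cst. Qed.

Lemma EfunT N (b : nat -> R[i]) (c : R[i]) x : Efun N b c x true = ctrig N b x.
Proof. by []. Qed.

Lemma EfunF N (b : nat -> R[i]) (c : R[i]) x : Efun N b c x false = c.
Proof. by []. Qed.

Lemma mult_diag N : (0 < N)%N ->
  mult (diag N) = Efun N (fun n => (2 * fejer_sqc R N n)%:C) 0.
Proof.
move=> N0; apply/funext => x; apply/funext => a.
rewrite /mult /diag big_map /Ec /=.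
under eq_bigr do rewrite (conv_zl1_Efun _ _ _ _ N0 (inZL1_Efun _ _ _)) fcos_Efun_false.
case: a.
  under eq_bigr do rewrite EfunT /ctrig.
  rewrite exchange_big [RHS]EfunT; apply: eq_bigr => n _ /=.
  rewrite -mulr_suml; congr (_ * _).
  rewrite (eq_bigr (fun q : coef * coef => (2^-1)%:C * ((if n == 0%N :> nat then 1 else 2^-1)%:C *
    ((q.1.1 n)%:C * (q.2.1 n)%:C) + (n == 0%N :> nat)%:R * ((q.1.2)%:C * (q.2.2)%:C)))); last first.
    by move=> q _; rewrite fcos_Efun_true//=; ring.
  rewrite -mulr_sumr big_split /= -!mulr_sumr !sum_realC diag_moment_CC diag_moment_BB// eqxx mul1r.
  rewrite (_ : (n == 0%N :> nat)%:R = ((n == 0%N :> nat)%:R)%:C); last by rewrite rmorph_nat.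
  rewrite -!rmorphM -!rmorphD -!rmorphM; congr (_%:C).
  (* Frequency 0 gets (2 + 2) / 2, one 2 coming from the square of the reflection part; for n >= 1
     the factors 1/2 of Haar measure and of cos^2 turn 8 into 2. *)
  by case: (nat_of_ord n =P 0%N) => [->|_]; rewrite ?fejer_sqc0 /=; field.
under eq_bigr do rewrite EfunF.
rewrite [RHS]EfunF -mulr_sumr (eq_bigr (fun q : coef * coef => (q.1.1 0%N)%:C * (q.2.2)%:C +
   (q.1.2)%:C * (q.2.1 0%N)%:C)); last first.
  by move=> q _; rewrite fcos_Efun_true//= rmorph1; ring.
rewrite big_split /= !sum_realC diag_moment_CB diag_moment_BC.
by rewrite !rmorph0 addr0 mulr0.
Qed.

Lemma nrm_Ec N (p : coef) : nrm (Ec N (ccoef_of p)) =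
  (2^-1 * (rint (fun x => `|trig N p.1 x|) + `|p.2|))%:E.
Proof.
rewrite nrmE; last exact: inL1_Efun.
rewrite /Ec /Efun /= cabs_real rint_cst; congr ((_ * (rint _ + _))%:E).
apply/funext => x; rewrite -cabs_real; congr cabs.
by rewrite /trig /ctrig rmorph_sum; apply: eq_bigr => n _; rewrite rmorphM.
Qed.

(** Nonnegative polynomials on T have norm half their constant coefficient. The N node terms
    contribute 2/N each, and the two corrections 6/4 and 2/4. *)
Lemma cost_diag N : (0 < N)%N -> cost (diag N) = 4%:E.
Proof.
move=> N0; have NR : N%:R != 0 :> R by rewrite pnatr_eq0 -lt0n.
rewrite /cost /diag big_map; under eq_bigr do rewrite !nrm_Ec -EFinM.
rewrite sumEFin sum_diag_coefs /=; congr EFin.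
have pos b : (forall x, 0 <= trig N b x) -> rint (fun x => `|trig N b x|) = b 0%N.
  move=> b0; rewrite -(rint_trig b N0); apply: eq_rint => x _.
  by rewrite ger0_norm.
have tZ c b x : trig N (fun n => c * b n) x = c * trig N b x.
  by rewrite /trig mulr_sumr; apply: eq_bigr => n _; rewrite mulrA.
have d0 x : trig N delta0 x = 1.
  case: N N0 {NR pos tZ} => // N _.
  rewrite /trig big_ord_recl big1 ?addr0 /delta0 ?cosn0 ?mulr1// => n _.
  by rewrite mul0r.
have rZ c b : (forall x, 0 <= trig N b x) ->
    rint (fun x => `|trig N (fun n => c * b n) x|) = `|c| * b 0%N.
  move=> b0; rewrite -pos// -rintZ.
    by apply: eq_rint => x _; rewrite tZ normrM.
  by apply: Lint_norm; apply: Lint_continuous; exact: continuous_trig.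
have nc j : nodec R N j 0 = 1 by rewrite /nodec /fejerc cosn0 mulr1.
rewrite (eq_bigr (fun=> 2 / N%:R)) => [|j _]; last first.
  rewrite rZ ?pos ?nc; try by move=> x; exact: nodec_ge0.
  rewrite ger0_norm ?divr_ge0// normr0; field.
  exact: NR.
rewrite sumr_const card_ord rZ; last by move=> x; rewrite d0.
rewrite (pos delta0); last by move=> x; rewrite d0.
rewrite (pos (fun=> 0)); last first.
  by move=> x; rewrite /trig big1// => n _; rewrite mul0r.
have -> : delta0 0 = 1 by [].
rewrite -[_ *+ N]mulr_natr !normrN !normr0 !normr1 !ger0_norm//.
by field.
Qed.

Lemma In_map (T U : Type) (P : U -> Prop) (F : T -> U) (s : seq T) :
  (forall t, P (F t)) -> forall p, List.In p (map F s) -> P p.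
Proof. by move=> PF p; elim: s => //= t s IH [<-|/IH]. Qed.

Lemma tensZ_diag N : tensZ (diag N).
Proof. by apply: In_map => q; split; exact: inZL1_Efun. Qed.

(** The factor 2 of the product cancels the Haar mass 1/2 of T, so f is convolved on each coset with
    the kernel of mass 1. *)
Lemma conv_mult_diag N f x a : (0 < N)%N -> inL1 f ->
  conv f (mult (diag N)) x a =
  cint (fun y => f y a * (trig N (fejer_sqc R N) (x - y))%:C).
Proof.
move=> N0 L1f; have /inL1P Lf := L1f; rewrite mult_diag//.
have E b : cint (fun y => f y b * ctrig N (fun n => (2 * fejer_sqc R N n)%:C) (x - y)) =
    2%:C * cint (fun y => f y b * (trig N (fejer_sqc R N) (x - y))%:C).
  rewrite -cintZ; last first.
    apply: LcM => //; apply: continuous_comp_sub; exact: continuous_trig.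
  apply: eq_cint => y; rewrite mulrCA; congr (_ * _).
  rewrite /trig /ctrig -rmorphM /= mulr_sumr rmorph_sum; apply: eq_bigr => n _.
  by rewrite -rmorphM /=; congr (_%:C); ring.
by case: a; rewrite ?conv_Efun_true ?conv_Efun_false// mul0r ?addr0 ?add0r E
  mulrA -rmorphM /= mulVf// mul1r.
Qed.

Lemma nrm_conv_mult_diag f (e : R) : inL1 f -> 0 < e ->
  exists N0, forall N, (N0 <= N)%N ->
    (nrm (subG (conv f (mult (diag N))) f) < e%:E)%E.
Proof.
(* Real and imaginary parts on two cosets give four errors below e / 2, and [nrm] halves their
   sum. *)
move=> L1f e0; have /inL1P Lf := L1f; have e2 : 0 < e / 2 by rewrite divr_gt0.
have [n1 h1] := korovkin_L1 (Lf true).1 e2.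
have [n2 h2] := korovkin_L1 (Lf true).2 e2.
have [n3 h3] := korovkin_L1 (Lf false).1 e2.
have [n4 h4] := korovkin_L1 (Lf false).2 e2.
exists (maxn 1 (maxn (maxn n1 n2) (maxn n3 n4))) => N.
rewrite !geq_max => /andP[N0 /andP[/andP[N1 N2] /andP[N3 N4]]].
move: (h1 _ N1) (h2 _ N2) (h3 _ N3) (h4 _ N4) => {h1 h2 h3 h4}.
set K := trig N (fejer_sqc R N).
have GE : subG (conv f (mult (diag N))) f =
    fun x a => cint (fun y => f y a * (K (x - y))%:C) - f x a.
  by apply/funext => x; apply/funext => a; rewrite /subG conv_mult_diag.
have GR a x : complex.Re (cint (fun y => f y a * (K (x - y))%:C) - f x a) =
    rint (fun y => complex.Re (f y a) * K (x - y)) - complex.Re (f x a).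
  rewrite cReB; congr (_ - _); congr rint; apply/funext => y.
  by rewrite cReM /= mulr0 subr0.
have GI a x : complex.Im (cint (fun y => f y a * (K (x - y))%:C) - f x a) =
    rint (fun y => complex.Im (f y a) * K (x - y)) - complex.Im (f x a).
  rewrite cImB; congr (_ - _); congr rint; apply/funext => y.
  by rewrite cImM /= mulr0 add0r.
have iR a : Lint (fun x => rint (fun y => complex.Re (f y a) * K (x - y)) - complex.Re (f x a)).
  apply: LintB; last exact: (Lf a).1.
  by apply: Lint_continuous; apply: continuous_conv_trig; exact: (Lf a).1.
have iI a : Lint (fun x => rint (fun y => complex.Im (f y a) * K (x - y)) - complex.Im (f x a)).
  apply: LintB; last exact: (Lf a).2.
  by apply: Lint_continuous; apply: continuous_conv_trig; exact: (Lf a).2.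
have LG a : Lc (fun x => cint (fun y => f y a * (K (x - y))%:C) - f x a).
  by split; [under eq_fun do rewrite GR|under eq_fun do rewrite GI].
have B a : rint (fun x => cabs (cint (fun y => f y a * (K (x - y))%:C) - f x a)) <=
    rint (fun x => `|rint (fun y => complex.Re (f y a) * K (x - y)) - complex.Re (f x a)|) +
    rint (fun x => `|rint (fun y => complex.Im (f y a) * K (x - y)) - complex.Im (f x a)|).
  rewrite -rintD; [|exact: Lint_norm..].
  apply: le_rint => [||x _].
  - exact: Lint_cabs.
  - by apply: LintD; exact: Lint_norm.
  - by rewrite (le_trans (cabs_le _))// GR GI.
rewrite GE nrmE; last by apply/inL1P.
have L (p q r1 r2 r3 r4 : R) : p <= r1 + r2 -> q <= r3 + r4 ->
    r1 < e / 2 -> r2 < e / 2 -> r3 < e / 2 -> r4 < e / 2 -> 2^-1 * (p + q) < e.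
  by lra.
rewrite lte_fin; exact: L (B true) (B false).
Qed.

End ApproximateDiagonal.

Theorem theorem1p11 (R : realType) : ZL1_amenable R.
Proof.
(* The bound is the exact cost of every [diag R N] with N > 0. *)
exists 4; split=> // F e FZ e0.
have [N0 hN] : exists N0, forall f, List.In f F -> forall N, (N0 <= N)%N ->
    (nrm (subG (Defs.conv f (mult (diag R N))) f) < e%:E)%E.
  elim: F FZ => [|f F IH] FZ; first by exists 0%N.
  have [n1 h1] := IH (fun g gF => FZ g (or_intror gF)).
  have [n2 h2] := nrm_conv_mult_diag (FZ f (or_introl erefl)).1 e0.
  exists (maxn n1 n2) => g /= [<-|gF] N; rewrite geq_max => /andP[N1 N2].
    exact: h2.
  exact: h1.
exists (diag R N0.+1); split; first exact: tensZ_diag.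
split; first by rewrite cost_diag.
move=> f fF; have Zf := FZ f fF; have [L1f _] := Zf.
have Nf := hN f fF N0.+1 (leqnSn _); split; last split=> //.
  (* The product of the diagonal is central, so the left and the right approximate identity
     estimates coincide. *)
  suff -> : Defs.conv (mult (diag R N0.+1)) f = Defs.conv f (mult (diag R N0.+1)) by [].
  apply/funext => x; apply/funext => a.
  by rewrite mult_diag// Efun_central.
exact: projnorm_comm_act.
Qed.
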